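(* Let $n\ge 1$ and let $g_1(\mathbf{x})=a_1x_1+\cdots+a_nx_n+r_1$ and $g_2(\mathbf{x})=b_1x_1+\cdots+b_nx_n+r_2$ be real affine functions on $\mathbb{R}^n$ with $(a_1,\dots,a_n)\neq 0$ and $(b_1,\dots,b_n)\ne 0$. Put $H_1=\{g_1=0\}$, $H_i^+=\{g_i\ge 0\}$ for $i=1,2$. Assume that the following good clipping conditions hold: (A) there is no $\mathbf{v}\in F^0$ with $g_1(\mathbf{v})=0$ and $g_2(\mathbf{v})>0$; (B) if there exists $\mathbf{v}\in F^0$ with $g_1(\mathbf{v})\ge 0$ and $g_2(\mathbf{v})>0$, then $\prod_{t=1}^n b_t\ne 0$; and for every $\mathbf{v}\in F^1$ with $g_1(\mathbf{v})=0$ and $g_2(\mathbf{v})>0$, $$b_{*(\mathbf{v})}\prod_{t\in[n]\setminus\{*(\mathbf{v})\}}\det\begin{pmatrix} a_{*(\mathbf{v})} & b_{*(\mathbf{v})}\\ a_t & b_t\end{pmatrix}\neq 0 .$$ Then $$\operatorname{vol}([0,1]^n\cap H_1^+\cap H_2^+)=\sum_{\mathbf{v}\in F^0\cap H_1^+\cap H_2^+}\frac{(-1)^{|0_{\mathbf{v}}|}\,g_2(\mathbf{v})^n}{n!\prod_{t=1}^n b_t}\;-\;\sum_{\mathbf{v}\in F^1\cap H_1\cap H_2^+}\frac{(-1)^{|0_{\mathbf{v}}|}\,a_{*(\mathbf{v})}^{\,n}\,g_2(\mathbf{v})^n}{n!\,|a_{*(\mathbf{v})}|\,b_{*(\mathbf{v})}\prod_{t\in[n]\setminus\{*(\mathbf{v})\}}\det\begin{pmatrix}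 a_{*(\mathbf{v})} & b_{*(\mathbf{v})}\\ a_t & b_t\end{pmatrix}},$$ where points $\mathbf{v}$ with $g_2(\mathbf{v})=0$ are omitted from both sums (they contribute $0$).
   Context: $[n]=\{1,\dots,n\}$. For $0\le d\le n$, $F^d$ is the set of points of $[0,1]^n$ having exactly $d$ coordinates different from $0$ and $1$ (the open $d$-skeleton of the cube); in particular $F^0=\{0,1\}^n$. For $\mathbf{v}\in\mathbb{R}^n$, $0_{\mathbf{v}}=\{i\in[n]: v_i=0\}$ and $|0_{\mathbf{v}}|$ is its cardinality. For $\mathbf{v}\in F^1$, $*(\mathbf{v})$ is the unique index $i$ with $v_i\notin\{0,1\}$. $\operatorname{vol}$ is Lebesgue measure on $\mathbb{R}^n$. Empty sums are $0$ and empty products are $1$. *)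

(* Defs.v *)
From HB Require Import structures.
From mathcomp Require Import all_boot all_order all_algebra.
From mathcomp Require Import all_classical all_reals all_analysis.

Set Implicit Arguments.
Unset Strict Implicit.
Unset Printing Implicit Defensive.

Import Order.TTheory GRing.Theory Num.Theory.
Import numFieldNormedType.Exports.

Local Open Scope classical_set_scope.
Local Open Scope ring_scope.

(* Lebesgue measure on R^n, with R^n represented by n-tuples and their product
   sigma-algebra, built as the iterated product of the one-dimensional Lebesgue
   measure; [lebesgue_tuple_box] is its characterization on boxes. *)
Section tuple_measure.
Context d (T : measurableType d) (R : realType).

Definition tuple_of_pair n (p : T * n.-tuple T) : n.+1.-tuple T :=
  [tuple of p.1 :: p.2].

Definition pair_of_tuple n (t : n.+1.-tuple T) : T * n.-tuple T :=
  (thead t, [tuple of behead t]).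

Lemma tuple_of_pairK n : cancel (@tuple_of_pair n) (@pair_of_tuple n).
Proof. by case=> x t; congr pair; exact: val_inj. Qed.

Lemma measurable_tuple_of_pair n :
  measurable_fun [set: T * n.-tuple T] (@tuple_of_pair n).
Proof. exact: measurable_cons. Qed.

Lemma measurable_pair_of_tuple n :
  measurable_fun [set: n.+1.-tuple T] (@pair_of_tuple n).
Proof.
apply/measurable_fun_pairP; split; last exact: measurable_behead.
exact: (measurable_tnth ord0).
Qed.

Section cons_measure.
Variables (m1 : {sigma_finite_measure set T -> \bar R}).
Variables (n : nat) (m : {sigma_finite_measure set (n.-tuple T) -> \bar R}).

Definition cons_measure : set (n.+1.-tuple T) -> \bar R :=
  pushforward (m1 \x m)%E (@tuple_of_pair n).

Let mf := @measurable_tuple_of_pair n.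

Let cons_measure0 : cons_measure set0 = 0%E.
Proof. by rewrite /cons_measure /pushforward preimage_set0 measure0. Qed.

Let cons_measure_ge0 A : (0 <= cons_measure A)%E.
Proof. exact: measure_ge0. Qed.

Let cons_measure_sigma_additive : semi_sigma_additive cons_measure.
Proof. exact: measure_semi_sigma_additive. Qed.

HB.instance Definition _ := isMeasure.Build _ _ _ cons_measure
  cons_measure0 cons_measure_ge0 cons_measure_sigma_additive.

Let cons_measure_sigma_finite : sigma_finite setT cons_measure.
Proof.
have /sigma_finiteP[F [FT ndF Foo]] := sigma_finiteT m1.
have /sigma_finiteP[G [GT ndG Goo]] := sigma_finiteT m.
exists (fun k => @pair_of_tuple n @^-1` (F k `*` G k)).
  apply/esym; rewrite -subTset => t _.
  have [k _ Fk] : (\bigcup_k F k) (pair_of_tuple t).1 by rewrite -FT.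
  have [l _ Gl] : (\bigcup_k G k) (pair_of_tuple t).2 by rewrite -GT.
  exists (maxn k l) => //; split.
    by move: Fk; exact/subsetPset/ndF/leq_maxl.
  by move: Gl; exact/subsetPset/ndG/leq_maxr.
move=> k; have [mF Fk] := Foo k; have [mG Gk] := Goo k; split.
  rewrite -[X in measurable X]setTI.
  by apply: measurable_pair_of_tuple => //; exact: measurableX.
rewrite /cons_measure /pushforward -comp_preimage.
rewrite (_ : _ \o _ = id); last by apply/funext; exact: tuple_of_pairK.
by rewrite preimage_id product_measure1E// lte_mul_pinfty// ge0_fin_numE.
Qed.

HB.instance Definition _ := Measure_isSigmaFinite.Build _ _ _ cons_measure
  cons_measure_sigma_finite.

End cons_measure.

End tuple_measure.

Section lebesgue_tuple.
Context {R : realType}.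
Local Notation T := (measurableTypeR R).

Fixpoint lebesgue_tuple n : {sigma_finite_measure set (n.-tuple T) -> \bar R} :=
  match n with
  | 0 => \d_[tuple]
  | n.+1 => cons_measure lebesgue_measure (lebesgue_tuple n)
  end.

Lemma lebesgue_tuple_box n (A : 'I_n -> set T) :
  (forall i, measurable (A i)) ->
  lebesgue_tuple n [set x | forall i, A i (tnth x i)] =
  (\prod_(i < n) lebesgue_measure (A i))%E.
Proof.
elim: n A => [|n IHn] A mA.
  by rewrite big_ord0 /= diracE mem_set //= => -[].
rewrite big_ord_recl -(IHn (A \o lift ord0)); last by move=> i; exact: mA.
have mB : measurable [set x : n.-tuple T | forall i, A (lift ord0 i) (tnth x i)].
  rewrite (_ : [set _ | _] =
      \bigcap_(i in [set: 'I_n]) ((@tnth n T ^~ i) @^-1` A (lift ord0 i))).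
    apply: fin_bigcap_measurable => [|i _]; first exact: finite_finset.
    by rewrite -[X in measurable X]setTI; exact: measurable_tnth.
  by apply/seteqP; split=> x /= => [h i _|h i]; [exact: h|exact: (h i I)].
rewrite -product_measure1E //=; congr product_measure1.
apply/seteqP; split=> -[x t] /=.
  move=> h; split; first exact: (h ord0).
  by move=> i; have := h (lift ord0 i); rewrite tnthS.
move=> [h0 h] i; have [j ->|->] := unliftP ord0 i.
  by have := h j; rewrite !(tnth_nth x).
exact: h0.
Qed.

End lebesgue_tuple.

Section cube.
Context {R : realType}.

Definition cube n : set (n.-tuple R) :=
  [set x | forall i, 0 <= tnth x i <= 1].

Definition skeleton d n : set (n.-tuple R) :=
  [set v | cube v /\ #|[set i | tnth v i \notin [:: 0; 1]]%SET| = d].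

Definition affine n (a : 'rV[R]_n) (r : R) (x : n.-tuple R) : R :=
  \sum_(i < n) a 0 i * tnth x i + r.

Definition hyperplane n (a : 'rV[R]_n) (r : R) : set (n.-tuple R) :=
  [set x | affine a r x = 0].

Definition halfspace n (a : 'rV[R]_n) (r : R) : set (n.-tuple R) :=
  [set x | 0 <= affine a r x].

Definition zeros n (v : n.-tuple R) : {set 'I_n} :=
  [set i | tnth v i == 0]%SET.

(* The value ord0 is a default, never taken on [skeleton 1 n.+1]. *)
Definition star n (v : n.+1.-tuple R) : 'I_n.+1 :=
  odflt ord0 [pick i | tnth v i \notin [:: 0; 1]].

Lemma starP n (v : n.+1.-tuple R) : skeleton 1 v ->
  forall i, (tnth v i \notin [:: 0; 1]) = (i == star v).
Proof.
case=> _ /eqP/cards1P[j /setP vj] i.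
have {}vj k : (tnth v k \notin [:: 0; 1]) = (k == j).
  by have := vj k; rewrite !inE.
rewrite vj /star; case: pickP => [k|/(_ j)]; rewrite vj ?eqxx //.
by move=> /eqP ->.
Qed.

Definition minor n (a b : 'rV[R]_n) (s t : 'I_n) : R :=
  \det (\matrix_(i < 2, j < 2)
    (if j == 0 then a else b) 0 (if i == 0 then s else t)).

Lemma minorE n (a b : 'rV[R]_n) (s t : 'I_n) :
  minor a b s t = a 0 s * b 0 t - b 0 s * a 0 t.
Proof.
rewrite /minor (expand_det_row _ ord0) !big_ord_recl big_ord0 /cofactor.
by rewrite !det_mx11 !mxE /= expr0 expr1 addr0 mul1r mulN1r mulrN.
Qed.

End cube.

Arguments cube {R} n.
Arguments skeleton {R} d n.

(* Main.v *)
Require Import Defs.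
From HB Require Import structures.
From mathcomp Require Import all_boot all_order all_algebra.
From mathcomp Require Import all_classical all_reals all_analysis.
From mathcomp Require Import measurable_realfun ring lra.

Set Implicit Arguments.
Unset Strict Implicit.
Unset Printing Implicit Defensive.

Import Order.TTheory GRing.Theory Num.Theory.
Import numFieldNormedType.Exports.

Local Open Scope classical_set_scope.
Local Open Scope ring_scope.

(** Write g1 = affine a r1 and g2 = affine b r2, and let truncpow k y be y^k / k!
    for y > 0 and 0 otherwise. The volume is the case k = 0 of the integrals
    (clipint) of 1_(g1 >= 0) truncpow k (g2) over the cube. All exponents k are
    treated at once because truncpow k is the derivative of truncpow (k + 1):
    integrating in one direction lowers the dimension by one and raises the
    exponent by one, which makes an induction on the dimension possible.

    For coordinates s and t, the vector u = a_s e_t - a_t e_s is parallel to the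
    hyperplane g1 = 0, and the derivative of truncpow (k + 1) (g2) along u is
    minor a b s t * truncpow k (g2). By the divergence theorem on the clipped
    cube, whose facet on g1 = 0 contributes nothing,
      minor a b s t * I_k = a_s (I_(k+1) at x_t = 1  -  I_(k+1) at x_t = 0)
                            - a_t (I_(k+1) at x_s = 1  -  I_(k+1) at x_s = 0),
    with integrals over facets of the cube on the right (clipint_facets). The
    claimed value, a sum over vertices minus a sum over clipped edges with
    powers of exponent n + k, satisfies the same recursion. On vertex terms this
    is the definition of the minor; on the terms of edges of direction m it is
    a_m minor s t = a_s minor m t - a_t minor m s. The good clipping conditions
    pass to facets, so the recursion settles every case in which some minor is
    nonzero (clipint_vertex_edge_sum).

    If all minors vanish, a and b are parallel. In dimension at least 2 the
    conditions then leave no clipped edge with g2 > 0, and the hyperplane g1 = 0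
    cannot separate two points of the cube where g2 > 0 (parallel_clip_covers).
    So the domain of integration is empty, or the first clip has no effect and
    the formula for a single halfspace applies (cubeint_truncpow). In dimension 1
    the clipped interval is integrated directly (clipint_dim1).

    The indicator of g1 >= 0 and the lowest truncated powers are not of class
    C^1. The recursion is therefore proved for integrands f(g1) g(g2) with f and
    g of class C^1, by Fubini and the fundamental theorem of calculus, and is
    carried over by dominated convergence. *)

(** * Inserting and removing a coordinate *)

Definition tinsert (X : Type) n (t : 'I_n.+1) (x : X) (y : n.-tuple X) :
    n.+1.-tuple X :=
  [tuple if unlift t i is Some j then tnth y j else x | i < n.+1].

Lemma tnth_tinsert (X : Type) n (t : 'I_n.+1) (x : X) (y : n.-tuple X) :
  tnth (tinsert t x y) t = x.
Proof. by rewrite tnth_mktuple unlift_none. Qed.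

Lemma tnth_tinsert_lift (X : Type) n (t : 'I_n.+1) (x : X) (y : n.-tuple X) j :
  tnth (tinsert t x y) (lift t j) = tnth y j.
Proof. by rewrite tnth_mktuple liftK. Qed.

Lemma tinsert0 (X : Type) n (x : X) (y : n.-tuple X) :
  tinsert ord0 x y = [tuple of x :: y].
Proof.
apply: eq_from_tnth => i; have [j ->|->] := unliftP ord0 i.
  by rewrite tnth_tinsert_lift tnthS.
by rewrite tnth_tinsert.
Qed.

Lemma tinsert_lift0 (X : Type) n (t : 'I_n.+1) (x z : X) (y : n.-tuple X) :
  tinsert (lift ord0 t) x [tuple of z :: y] = [tuple of z :: tinsert t x y].
Proof.
apply: eq_from_tnth => i; have [j ->|->] := unliftP (lift ord0 t) i.
  rewrite tnth_tinsert_lift; have [k ->|->] := unliftP ord0 j.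
    have -> : lift (lift ord0 t) (lift ord0 k) = lift ord0 (lift t k).
      by apply: val_inj; rewrite /= /bump /= !add1n ltnS addnS.
    by rewrite !tnthS tnth_tinsert_lift.
  have -> : lift (lift ord0 t) ord0 = ord0 by apply: val_inj.
  by [].
by rewrite tnth_tinsert tnthS tnth_tinsert.
Qed.

Definition tremove (X : Type) n (t : 'I_n.+1) (w : n.+1.-tuple X) : n.-tuple X :=
  [tuple tnth w (lift t j) | j < n].

Lemma tinsertK (X : Type) n (t : 'I_n.+1) (w : n.+1.-tuple X) :
  tinsert t (tnth w t) (tremove t w) = w.
Proof.
apply: eq_from_tnth => i; have [j ->|->] := unliftP t i.
  by rewrite tnth_tinsert_lift tnth_mktuple.
by rewrite tnth_tinsert.
Qed.

Lemma tremoveK (X : Type) n (t : 'I_n.+1) (x : X) (y : n.-tuple X) :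
  tremove t (tinsert t x y) = y.
Proof. by apply: eq_from_tnth => i; rewrite tnth_mktuple tnth_tinsert_lift. Qed.

Lemma big_tinsert (A : Type) (idx : A) (op : Monoid.com_law idx) n (t : 'I_n.+1)
    (P : pred (n.+1.-tuple bool)) (F : n.+1.-tuple bool -> A) :
  \big[op/idx]_(w | P w) F w =
  op (\big[op/idx]_(w | P (tinsert t true w)) F (tinsert t true w))
     (\big[op/idx]_(w | P (tinsert t false w)) F (tinsert t false w)).
Proof.
rewrite (reindex (fun p : bool * n.-tuple bool => tinsert t p.1 p.2)); last first.
  exists (fun w => (tnth w t, tremove t w)) => [[e w] _|w _] /=.
    by rewrite tnth_tinsert tremoveK.
  exact: tinsertK.
rewrite -(pair_big_dep xpredT (fun e w => P (tinsert t e w))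
  (fun e w => F (tinsert t e w))) /=.
by rewrite big_bool.
Qed.

Lemma big_tuple0 (A : Type) (idx : A) (op : Monoid.com_law idx) (X : finType)
    (P : pred (0.-tuple X)) (F : 0.-tuple X -> A) :
  \big[op/idx]_(w | P w) F w = if P [tuple] then F [tuple] else idx.
Proof.
rewrite big_mkcond (bigD1 [tuple])//= big1 ?Monoid.mulm1// => w.
by move=> /eqP[]; exact: tuple0.
Qed.

Lemma big_lift (A : Type) (idx : A) (op : Monoid.com_law idx) n (t : 'I_n.+1)
    (P : pred 'I_n.+1) (F : 'I_n.+1 -> A) :
  \big[op/idx]_(j | (j != t) && P j) F j =
  \big[op/idx]_(j < n | P (lift t j)) F (lift t j).
Proof.
rewrite big_mkcond (bigD1_ord t)//= eqxx Monoid.mul1m [RHS]big_mkcond.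
by apply: eq_bigr => j _; rewrite eq_sym neq_lift.
Qed.

(** * Fubini in an arbitrary coordinate *)

Section integration.
Context {R : realType}.
Local Notation T := (measurableTypeR R).
Local Notation mu := (@lebesgue_measure R).

Lemma measurable_tinsert n (t : 'I_n.+1) d (S : measurableType d)
    (f : S -> T) (g : S -> n.-tuple T) :
  measurable_fun [set: S] f -> measurable_fun [set: S] g ->
  measurable_fun setT (fun s => tinsert t (f s) (g s)).
Proof.
move=> mf mg; apply/measurable_fun_tnthP => i.
have [j ->|->] := unliftP t i.
  rewrite (_ : _ \o _ = fun s => tnth (g s) j).
    exact: (measurableT_comp (measurable_tnth j) mg).
  by apply/funext => s /=; rewrite tnth_tinsert_lift.
rewrite (_ : _ \o _ = f)//.
by apply/funext => s /=; rewrite tnth_tinsert.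
Qed.

Local Open Scope ereal_scope.

(** The measure on tuples is built by adding coordinates at the front, so the
    coordinate t reaches the innermost position by induction: each step
    exchanges it with the first coordinate of the remaining tuple. *)
Lemma tonelli_tinsert n (t : 'I_n.+1) (f : n.+1.-tuple T -> \bar R) :
  measurable_fun [set: n.+1.-tuple T] f -> (forall x, 0 <= f x) ->
  \int[lebesgue_tuple n.+1]_z f z =
  \int[lebesgue_tuple n]_y \int[mu]_x f (tinsert t x y).
Proof.
have consE m (g : m.+1.-tuple T -> \bar R) :
    measurable_fun [set: m.+1.-tuple T] g -> (forall x, 0 <= g x) ->
    \int[lebesgue_tuple m.+1]_z g z =
    \int[mu \x lebesgue_tuple m]_p g [tuple of p.1 :: p.2].
  by move=> mg g0; rewrite (ge0_integral_pushforward (@measurable_tuple_of_pair _ T m)).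
elim: n t f => [|n IHn] t f mf f0.
  rewrite consE// fubini_tonelli2//.
    by apply: eq_integral => y _; apply: eq_integral => x _; rewrite ord1 tinsert0.
  by apply: measurableT_comp => //; exact: measurable_tuple_of_pair.
have mfc : measurable_fun setT (fun p : T * n.+1.-tuple T => f [tuple of p.1 :: p.2]).
  by apply: measurableT_comp => //; exact: measurable_tuple_of_pair.
have [j ->|->] := unliftP ord0 t; last first.
  rewrite consE// fubini_tonelli2//.
  by apply: eq_integral => y _; apply: eq_integral => x _; rewrite tinsert0.
have mfi : measurable_fun setT
    (fun p : n.+1.-tuple T * T => f (tinsert (lift ord0 j) p.2 p.1)).
  apply: measurableT_comp => //; exact: measurable_tinsert.
have mG := measurable_fun_fubini_tonelli_F (m2 := mu) _ mfi (fun _ => f0 _).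
rewrite [RHS](consE n (fun y => \int[mu]_x f (tinsert (lift ord0 j) x y))) //; last first.
  by move=> y; exact: integral_ge0.
rewrite (fubini_tonelli1 (fun p : T * n.-tuple T =>
   \int[mu]_x f (tinsert (lift ord0 j) x [tuple of p.1 :: p.2]))); last first.
- by move=> p; exact: integral_ge0.
- exact: (measurableT_comp mG (@measurable_tuple_of_pair _ T _)).
rewrite consE// fubini_tonelli1//.
apply: eq_integral => z _; rewrite /fubini_F /=.
rewrite (IHn j) => [|//|//]; last first.
  by apply: measurableT_comp => //; exact: measurable_cons.
by apply: eq_integral => y _; apply: eq_integral => x _; rewrite tinsert_lift0.
Qed.

End integration.

(** * Integrals over the unit cube *)

Section cubeint.
Context {R : realType}.
Local Notation T := (measurableTypeR R).
Local Notation mu := (@lebesgue_measure R).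

Lemma measurable_cube n : measurable (cube n : set (n.-tuple T)).
Proof.
rewrite (_ : cube n =
    \bigcap_(i in [set: 'I_n]) ((@tnth n T ^~ i) @^-1` `[0%R, 1%R])).
  apply: fin_bigcap_measurable => [|i _]; first exact: finite_finset.
  by rewrite -[X in measurable X]setTI; exact: measurable_tnth.
apply/seteqP; split=> x /= h.
  by move=> i _ /=; rewrite in_itv /=; exact: h.
by move=> i; have /= := h i I; rewrite in_itv.
Qed.

Lemma lebesgue_tuple_cube n : lebesgue_tuple n (cube n : set (n.-tuple T)) = 1%E.
Proof.
rewrite (_ : cube n = [set x : n.-tuple T | forall i, `[0, 1]%classic (tnth x i)]).
  pose A (i : 'I_n) : set T := `[0, 1]%classic.
  apply: etrans (lebesgue_tuple_box (A := A) _) _.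
    by move=> i; exact: measurable_itv.
  rewrite big1// => i _; rewrite /A.
  by rewrite lebesgue_measure_itv /= lte_fin ltr01 sube0.
by apply/seteqP; split=> x /= h i; have := h i; rewrite /= in_itv.
Qed.

Definition cubeint n (f : n.-tuple R -> R) : R :=
  \int[lebesgue_tuple n]_(x in (cube n : set (n.-tuple T))) f x.

(** Measurable on the whole space but bounded on the cube only: this is the class
    that contains the affine functions and is closed under products. *)
Definition bounded_mfun n (f : n.-tuple R -> R) :=
  measurable_fun [set: n.-tuple T] (f : n.-tuple T -> R) /\
  exists M, forall x, cube n x -> `|f x| <= M.

Lemma bounded_mfun_integrable n (f : n.-tuple R -> R) : bounded_mfun f ->
  (lebesgue_tuple n).-integrable (cube n : set (n.-tuple T)) (EFin \o f).
Proof.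
move=> [mf [M fM]]; apply: measurable_bounded_integrable.
- exact: measurable_cube.
- rewrite -[X in (X < _)%E]/(lebesgue_tuple n (cube n : set (n.-tuple T))).
  by rewrite lebesgue_tuple_cube ltry.
- exact: measurable_funTS.
- exists M; split; first exact: num_real.
  by move=> K MK x cx; apply: le_trans (ltW MK); exact: fM.
Qed.

Lemma bounded_mfun_cst n (c : R) : bounded_mfun (fun _ : n.-tuple R => c).
Proof. by split; [exact: measurable_cst|exists `|c|]. Qed.

Lemma bounded_mfunD n (f g : n.-tuple R -> R) : bounded_mfun f -> bounded_mfun g ->
  bounded_mfun (fun x => f x + g x).
Proof.
move=> [mf [M fM]] [mg [N gN]]; split; first exact: measurable_funD.
exists (M + N) => x cx; apply: (le_trans (ler_normD _ _)).
by apply: lerD; [exact: fM|exact: gN].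
Qed.

Lemma bounded_mfunM n (f g : n.-tuple R -> R) : bounded_mfun f -> bounded_mfun g ->
  bounded_mfun (fun x => f x * g x).
Proof.
move=> [mf [M fM]] [mg [N gN]]; split; first exact: measurable_funM.
exists (M * N) => x cx; rewrite normrM.
by apply: ler_pM => //; [exact: fM|exact: gN].
Qed.

Lemma bounded_mfunZ n (c : R) (f : n.-tuple R -> R) :
  bounded_mfun f -> bounded_mfun (fun x => c * f x).
Proof. by apply: bounded_mfunM; exact: bounded_mfun_cst. Qed.

Lemma bounded_mfun_affine n (a : 'rV[R]_n) r : bounded_mfun (affine a r).
Proof.
split.
  apply: measurable_funD; last exact: measurable_cst.
  apply: measurable_sum => i; apply: measurable_funM.
    exact: measurable_cst.
  exact: measurable_tnth.
exists (\sum_i `|a 0 i| + `|r|) => x cx; apply: (le_trans (ler_normD _ _)).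
rewrite lerD2r; apply: (le_trans (ler_norm_sum _ _ _)).
apply: ler_sum => i _; rewrite normrM ler_piMr//.
by have /andP[x0 x1] := cx i; rewrite ger0_norm.
Qed.

Definition locbounded_mfun (u : R -> R) :=
  measurable_fun [set: R] u /\
  forall K, exists M, forall y, `|y| <= K -> `|u y| <= M.

Lemma bounded_mfun_comp n (u : R -> R) (f : n.-tuple R -> R) :
  locbounded_mfun u -> bounded_mfun f -> bounded_mfun (u \o f).
Proof.
move=> [mu_ lu] [mf [M fM]]; split; first exact: measurableT_comp.
by have [N uN] := lu M; exists N => x cx; apply: uN; exact: fM.
Qed.

Lemma cubeintD n (f g : n.-tuple R -> R) : bounded_mfun f -> bounded_mfun g ->
  cubeint (fun x => f x + g x) = cubeint f + cubeint g.
Proof.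
by move=> bf bg; apply: RintegralD;
  [exact: measurable_cube|exact: bounded_mfun_integrable|exact: bounded_mfun_integrable].
Qed.

Lemma cubeintB n (f g : n.-tuple R -> R) : bounded_mfun f -> bounded_mfun g ->
  cubeint (fun x => f x - g x) = cubeint f - cubeint g.
Proof.
by move=> bf bg; apply: RintegralB;
  [exact: measurable_cube|exact: bounded_mfun_integrable|exact: bounded_mfun_integrable].
Qed.

Lemma cubeintZ n c (f : n.-tuple R -> R) : bounded_mfun f ->
  cubeint (fun x => c * f x) = c * cubeint f.
Proof.
by move=> bf; apply: RintegralZl; [exact: measurable_cube|exact: bounded_mfun_integrable].
Qed.

Lemma cubeint_cst n c : cubeint (fun _ : n.-tuple R => c) = c.
Proof.
rewrite /cubeint Rintegral_cst; last exact: measurable_cube.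
by rewrite -[X in fine X]/(lebesgue_tuple n (cube n : set (n.-tuple T)))
  lebesgue_tuple_cube mulr1.
Qed.

Lemma eq_cubeint n (f g : n.-tuple R -> R) :
  (forall x, cube n x -> f x = g x) -> cubeint f = cubeint g.
Proof. by move=> fg; apply: eq_Rintegral => x /[!inE]; exact: fg. Qed.

Lemma cube_tinsert n (t : 'I_n.+1) (x : R) (y : n.-tuple R) :
  cube n.+1 (tinsert t x y) <-> (0 <= x <= 1) /\ cube n y.
Proof.
split=> [h|[x01 h] i].
  split; first by have := h t; rewrite tnth_tinsert.
  by move=> j; have := h (lift t j); rewrite tnth_tinsert_lift.
by have [j ->|->] := unliftP t i; rewrite ?tnth_tinsert_lift ?tnth_tinsert.
Qed.

Lemma bounded_integrable_itv (f : R -> R) (l u M : R) :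
  measurable_fun [set: T] f -> (forall x, l <= x <= u -> `|f x| <= M) ->
  mu.-integrable `[l, u] (EFin \o f).
Proof.
move=> mf fM; apply: measurable_bounded_integrable => //.
- rewrite -[X in (X < _)%E]/(mu `[l, u]%classic) lebesgue_measure_itv/=.
  by case: ifP; rewrite ?ltry.
- exact: measurable_funTS.
- exists M; split; first exact: num_real.
  move=> K MK x /=; rewrite in_itv /= => xlu.
  by apply: le_trans (ltW MK); exact: fM.
Qed.

Lemma integrable_tinsert n (t : 'I_n.+1) (f : n.+1.-tuple R -> R) y :
  bounded_mfun f -> cube n y ->
  mu.-integrable `[0, 1] (EFin \o (fun x => f (tinsert t x y))).
Proof.
move=> [mf [M fM]] cy; apply: (@bounded_integrable_itv _ _ _ M).
  apply: (measurableT_comp mf); apply: measurable_tinsert.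
    exact: measurable_id.
  exact: measurable_cst.
by move=> x x01; apply: fM; exact/cube_tinsert.
Qed.

(** Tonelli applied to the extension of f by 0 outside the cube. The second
    part serves to subtract a constant under the outer integral; the indicator
    is there because the inner integral is controlled on the cube only. *)
Let cubeint_slice_ge0 n (t : 'I_n.+1) (f : n.+1.-tuple R -> R) : bounded_mfun f ->
  (forall x, cube n.+1 x -> 0 <= f x) ->
  cubeint f = cubeint (fun y => \int[mu]_(x in `[0, 1]) f (tinsert t x y)) /\
  bounded_mfun (fun y => (\int[mu]_(x in `[0, 1]) f (tinsert t x y)) * \1_(cube n) y).
Proof.
move=> bf f0; have [mf [M fM]] := bf.
pose F : n.+1.-tuple T -> \bar R := (EFin \o f) \_ (cube n.+1).
have mF : measurable_fun [set: n.+1.-tuple T] F.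
  apply/(measurable_restrictT _ (@measurable_cube n.+1)).
  by apply/measurable_EFinP/measurable_funTS.
have F0 x : (0 <= F x)%E.
  by rewrite /F patchE; case: ifPn => // /[!inE] cx; rewrite lee_fin; exact: f0.
pose G y := \int[mu]_(x in `[0, 1]) f (tinsert t x y).
have Fin (y : n.-tuple T) : (\int[mu]_x F (tinsert t x y))%E =
    ((EFin \o G) \_ (cube n)) y.
  rewrite patchE; case: ifPn => [|/negP] /[!inE] cy.
    transitivity (\int[mu]_(x in `[0%R, 1%R]) (f (tinsert t x y))%:E)%E.
      rewrite [RHS]integral_mkcond; apply: eq_integral => x _.
      rewrite /F !patchE; congr (if _ then _ else _).
      apply/idP/idP => /[!inE] /=; rewrite in_itv /=.
        by move=> /cube_tinsert[].
      by move=> x01; exact/cube_tinsert.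
    rewrite /= /Rintegral fineK//; apply: integrable_fin_num => //.
    exact: integrable_tinsert.
  apply: integral0_eq => x _; rewrite /F patchE; case: ifPn => // /[!inE].
  by move=> /cube_tinsert[_ /cy].
split.
  rewrite /cubeint /Rintegral; congr fine.
  rewrite integral_mkcond (tonelli_tinsert t mF F0).
  by rewrite [RHS]integral_mkcond; apply: eq_integral => y _; exact: Fin.
split.
  have mG := measurable_fun_fubini_tonelli_F (m2 := mu)
    (fun p : n.-tuple T * T => F (tinsert t p.2 p.1)) _ (fun _ => F0 _).
  have {}mG := mG (measurableT_comp mF
    (measurable_tinsert _ measurable_snd measurable_fst)).
  rewrite (_ : (fun y => _) =
     fine \o (fun y => (\int[mu]_x F (tinsert t x y)))%E).
    exact: (measurableT_comp (fine_measurable measurableT) mG).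
  apply/funext => y /=; rewrite Fin patchE indicE.
  by case: ifPn => //= _; rewrite ?mulr1 ?mulr0.
exists M => y cy; rewrite indicE mem_set// mulr1.
apply: (le_trans (le_normr_Rintegral _ (integrable_tinsert t bf cy))) => //.
have -> : M = \int[mu]_(x in `[0, 1]) M.
  by rewrite Rintegral_cst//= lebesgue_measure_itv /= lte_fin ltr01 sube0 mulr1.
apply: le_Rintegral => //.
- exact/integrable_norm/integrable_tinsert.
- apply: (@bounded_integrable_itv _ _ _ `|M|) => //; exact: measurable_cst.
- by move=> x /=; rewrite in_itv /= => x01; apply: fM; exact/cube_tinsert.
Qed.

(** Reduction to a nonnegative integrand by adding a bound of the function. *)
Lemma cubeint_slice n (t : 'I_n.+1) (f : n.+1.-tuple R -> R) : bounded_mfun f ->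
  cubeint f = cubeint (fun y => \int[mu]_(x in `[0, 1]) f (tinsert t x y)).
Proof.
move=> bf; have [_ [M fM]] := bf.
have bg : bounded_mfun (fun x => f x + M).
  by apply: bounded_mfunD => //; exact: bounded_mfun_cst.
have g0 x : cube n.+1 x -> 0 <= f x + M.
  by move=> /fM; rewrite ler_norml => /andP[+ _]; rewrite -subr_ge0 opprK.
have [E bi] := cubeint_slice_ge0 t bg g0.
have -> : cubeint f = cubeint (fun x => f x + M) - M.
  by rewrite cubeintD ?cubeint_cst ?addrK//; exact: bounded_mfun_cst.
rewrite E.
rewrite (@eq_cubeint _ _ (fun y =>
  (\int[mu]_(x in `[0, 1]) (f (tinsert t x y) + M)) * \1_(cube n) y)); last first.
  by move=> y cy; rewrite indicE mem_set// mulr1.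
rewrite -[X in _ - X](cubeint_cst n) -cubeintB//; last exact: bounded_mfun_cst.
apply: eq_cubeint => y cy; rewrite indicE mem_set// mulr1.
rewrite RintegralD//.
- by rewrite Rintegral_cst//= lebesgue_measure_itv /= lte_fin ltr01 sube0 mulr1 addrK.
- exact: integrable_tinsert.
- by apply: (@bounded_integrable_itv _ _ _ `|M|) => //; exact: measurable_cst.
Qed.

End cubeint.

(** * Truncated powers and functions of class C^1 *)

Section calculus.
Context {R : realType}.
Local Notation T := (measurableTypeR R).
Local Notation mu := (@lebesgue_measure R).

Let ctsM (f g : R -> R) : continuous f -> continuous g ->
  continuous (fun x => f x * g x).
Proof. by move=> cf cg x; exact: (continuousM (cf x) (cg x)). Qed.

Let ctsD (f g : R -> R) : continuous f -> continuous g ->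
  continuous (fun x => f x + g x).
Proof. by move=> cf cg x; exact: (continuousD (cf x) (cg x)). Qed.

Let cts_comp (f g : R -> R) : continuous f -> continuous g ->
  continuous (fun x => f (g x)).
Proof. by move=> cf cg x; exact: (continuous_comp (cg x) (cf (g x))). Qed.

Let cts_cst (c : R) : continuous (fun _ : R => c).
Proof. by move=> x; exact: cvg_cst. Qed.

(** At k = 0 this is the indicator of y > 0, with value 0 at y = 0. *)
Definition truncpow (k : nat) (y : R) : R :=
  if 0 < y then y ^+ k / k`!%:R else 0.

Lemma truncpowE k y : truncpow k.+1 y = Num.max y 0 ^+ k.+1 / k.+1`!%:R.
Proof. by rewrite /truncpow; case: ltP => //; rewrite expr0n/= mul0r. Qed.

Lemma continuous_truncpow k : continuous (truncpow k.+1).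
Proof.
have -> : truncpow k.+1 = (fun y => Num.max y 0 ^+ k.+1 * (k.+1`!%:R)^-1).
  by apply/funext => y; rewrite truncpowE.
apply: ctsM; last exact: cts_cst.
apply: (cts_comp (f := fun z => z ^+ k.+1)); first exact: exprn_continuous.
move=> y; apply: (@continuous_max R R id (cst 0)); last exact: cvg_cst.
exact: cvg_id.
Qed.

(** Away from 0 the function is locally 0 or a monomial. At 0 its difference
    quotient is truncpow (k + 1) / (k + 2), which is continuous and vanishes
    there. *)
Lemma is_derive_truncpow k (y : R) : is_derive y 1 (truncpow k.+2) (truncpow k.+1 y).
Proof.
have [y0|y0|->] := ltgtP y 0.
- apply: (near_eq_is_derive (f := cst 0)).
    near=> z; rewrite /truncpow /= ltNge ltW//; near: z.
    exact: lt_nbhsl.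
  by apply: is_derive_eq; rewrite /truncpow ltNge ltW.
- have dX c : is_derive y (1 : R) (fun z : R => c * z ^+ k.+2)
      (c * (k.+2%:R * y ^+ k.+1)).
    have H := is_deriveX k.+2 (is_derive_id y (1 : R)).
    rewrite fctE in H; have {}H := is_deriveZ c H.
    apply: (DeriveDef (@ex_derive _ _ _ _ _ _ _ H)).
    by rewrite derive_val /GRing.scale/= mulr1.
  apply: (near_eq_is_derive (f := fun z : R => (k.+2`!%:R)^-1 * z ^+ k.+2)).
    near=> z; have z0 : 0 < z by near: z; exact: lt_nbhsr.
    by rewrite /truncpow z0; exact: mulrC.
  rewrite (_ : truncpow k.+1 y = (k.+2`!%:R)^-1 * (k.+2%:R * y ^+ k.+1)).
    exact: dX.
  rewrite /truncpow y0 (factS k.+1) natrM.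
  have k0 : k.+1`!%:R != 0 :> R by rewrite pnatr_eq0 -lt0n fact_gt0.
  have K0 : k.+2%:R != 0 :> R by rewrite pnatr_eq0.
  move: (y ^+ k.+1) (k.+1`!%:R) (k.+2%:R) k0 K0 => z c K c0 K0.
  by field; rewrite c0 K0.
- have tp0 j : truncpow j 0 = 0 by rewrite /truncpow ltxx.
  have cv : (fun h : R =>
      h^-1 *: (truncpow k.+2 (h *: 1 + 0) - truncpow k.+2 0)) @ 0^' --> (0 : R).
    have c0 : truncpow k.+1 h @[h --> 0^'] --> truncpow k.+1 (0 : R).
      by apply: cvg_trans (@continuous_truncpow k 0); apply: cvg_app; exact: cvg_within.
    have c1 : k.+2%:R^-1 * truncpow k.+1 h @[h --> 0^'] --> (0 : R).
      have := cvgM (cvg_cst (k.+2%:R^-1 : R)) c0; rewrite tp0 mulr0.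
      exact.
    apply: cvg_trans c1; rewrite tp0.
    apply: near_eq_cvg; near=> h.
    have h0 : h != 0 by near: h; exact: nbhs_dnbhs_neq.
    rewrite /GRing.scale/= addr0 subr0 mulr1 /truncpow; case: ifP; rewrite ?mulr0//.
    have k0 : k.+1`!%:R != 0 :> R by rewrite pnatr_eq0 -lt0n fact_gt0.
    have K0 : k.+2%:R != 0 :> R by rewrite pnatr_eq0.
    move=> _; rewrite (factS k.+1) natrM (exprS h k.+1).
    move: (h ^+ k.+1) (k.+1`!%:R) (k.+2%:R) k0 K0 => z c K cn0 K0.
    by field; rewrite cn0 K0 h0.
  rewrite tp0; apply: DeriveDef.
    by apply/cvg_ex; exists 0; exact: cv.
  by apply/cvg_lim => //; exact: cv.
Unshelve. all: by end_near.
Qed.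

(** The derivative is a parameter so that it can be written in closed form. *)
Definition C1 (f f' : R -> R) :=
  (forall y : R, is_derive y (1 : R) f (f' y)) /\ continuous f'.

Lemma C1_truncpow k : C1 (truncpow k.+2) (truncpow k.+1).
Proof. by split; [exact: is_derive_truncpow|exact: continuous_truncpow]. Qed.

Lemma C1_continuous f f' : C1 f f' -> continuous f.
Proof.
move=> [df _] y; apply: differentiable_continuous; apply/derivable1_diffP.
by have := df y.
Qed.

Lemma continuous_locbounded (f : R -> R) : continuous f -> locbounded_mfun f.
Proof.
move=> cf; split; first exact: continuous_measurable_fun.
move=> K; have : compact (f @` `[- K, K]).
  by apply: continuous_compact; [exact: continuous_subspaceT|exact: segment_compact].
move=> /compact_bounded[M [_ fM]]; exists (`|M| + 1) => y yK; apply: (fM (`|M| + 1)).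
  by rewrite ltr_pwDr// ler_norm.
by exists y => //=; rewrite in_itv/= -ler_norml.
Qed.

Lemma Rintegral_C1 (F f : R -> R) l u : l <= u -> C1 F f ->
  \int[mu]_(x in `[l, u]) f x = F u - F l.
Proof.
rewrite le_eqVlt => /predU1P[<- _|lu CF].
  by rewrite subrr set_itv1 Rintegral_set1.
have cF := C1_continuous CF; case: CF => dF cf.
rewrite /Rintegral (@continuous_FTC2 _ _ F)//.
- exact: continuous_subspaceT.
- split.
  + by move=> x _; have := dF x.
  + exact/cvg_at_right_filter/cF.
  + exact/cvg_at_left_filter/cF.
- by move=> x _; rewrite derive1E derive_val.
Qed.

Lemma C1_affine (f f' : R -> R) a c : C1 f f' ->
  C1 (fun x => f (a * x + c)) (fun x => a * f' (a * x + c)).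
Proof.
move=> [df cf']; split=> [y|y].
  rewrite mulrC; apply: (@is_derive1_comp _ f (fun x => a * x + c)) => //.
  by apply: is_derive_eq; rewrite /GRing.scale/= mulr1 addr0.
move: y; apply: ctsM; first exact: cts_cst.
apply: cts_comp => //; apply: ctsD; last exact: cts_cst.
by apply: ctsM; [exact: cts_cst|move=> y; exact: cvg_id].
Qed.

Lemma C1_mul (f f' g g' : R -> R) : C1 f f' -> C1 g g' ->
  C1 (fun x => f x * g x) (fun x => f' x * g x + f x * g' x).
Proof.
move=> Cf Cg; have cf := C1_continuous Cf; have cg := C1_continuous Cg.
case: Cf Cg => [df cf'] [dg cg']; split=> y.
  have ? := df y; have ? := dg y.
  by apply: is_derive_eq; rewrite /GRing.scale/= addrC mulrC.
by move: y; apply: ctsD; apply: ctsM.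
Qed.

Lemma C1_cst (c : R) : C1 (fun=> c) (fun=> 0).
Proof. by split=> y; [exact: is_derive_cst|exact: cvg_cst]. Qed.

Lemma C1_add (f f' g g' : R -> R) : C1 f f' -> C1 g g' ->
  C1 (fun x => f x + g x) (fun x => f' x + g' x).
Proof.
move=> [df cf'] [dg cg']; split; last exact: ctsD.
by move=> y; have ? := df y; have ? := dg y; apply: is_derive_eq.
Qed.

Lemma C1_scale (c : R) (f f' : R -> R) : C1 f f' ->
  C1 (fun x => c * f x) (fun x => c * f' x).
Proof.
move=> Cf; have := C1_mul (C1_cst c) Cf.
rewrite (_ : (fun x => 0 * f x + c * f' x) = (fun x => c * f' x))//.
by apply/funext => x; rewrite mul0r add0r.
Qed.

Lemma C1_inv (f f' : R -> R) : C1 f f' -> (forall y, f y != 0) ->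
  C1 (fun x => (f x)^-1) (fun x => - ((f x)^-1 * (f x)^-1) * f' x).
Proof.
move=> Cf f0; have cf := C1_continuous Cf; case: Cf => df cf'.
have cV : continuous (fun x => (f x)^-1).
  by move=> x; apply: cvgV; [exact: f0|exact: cf].
split=> y.
  rewrite -invfM -expr2; exact: is_deriveV.
move: y; apply: ctsM => //.
rewrite (_ : (fun x => - _) = (fun x => -1 * ((f x)^-1 * (f x)^-1))).
  by apply: ctsM; [exact: cts_cst|exact: ctsM].
by apply/funext => x; rewrite mulN1r.
Qed.

End calculus.

(** * The divergence identity for products of ridge functions *)

Section clipped.
Context {R : realType}.
Local Notation T := (measurableTypeR R).
Local Notation mu := (@lebesgue_measure R).

Lemma affine_tinsert n (a : 'rV[R]_n.+1) r (t : 'I_n.+1) x (y : n.-tuple R) :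
  affine a r (tinsert t x y) = affine (col' t a) (a 0 t * x + r) y.
Proof.
rewrite /affine (bigD1_ord t)//= tnth_tinsert -addrA addrCA; congr (_ + _).
by apply: eq_bigr => j _; rewrite tnth_tinsert_lift mxE.
Qed.

(** The fundamental theorem of calculus on every segment of direction t, followed
    by Fubini: the derivative of f(g1) g(g2) in x_t has the two terms on the
    left, and a facet x_t = e carries the coefficients col' t a and col' t b and
    the constants a_t e + r1 and b_t e + r2. *)
Lemma cubeint_derive_facets n (a b : 'rV[R]_n.+1) r1 r2 (t : 'I_n.+1)
    (f f' g g' : R -> R) :
  C1 f f' -> C1 g g' ->
  a 0 t * cubeint (fun x => f' (affine a r1 x) * g (affine b r2 x)) +
  b 0 t * cubeint (fun x => f (affine a r1 x) * g' (affine b r2 x)) =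
  cubeint (fun y => f (affine (col' t a) (a 0 t + r1) y) *
                    g (affine (col' t b) (b 0 t + r2) y)) -
  cubeint (fun y => f (affine (col' t a) r1 y) * g (affine (col' t b) r2 y)).
Proof.
move=> Cf Cg; have cf := C1_continuous Cf; have cg := C1_continuous Cg.
have bm m (u v : R -> R) (c d : 'rV[R]_m) e h : continuous u -> continuous v ->
    bounded_mfun (fun x => u (affine c e x) * v (affine d h x)).
  by move=> cu cv; apply: bounded_mfunM; apply: bounded_mfun_comp;
    by [exact: continuous_locbounded|exact: bounded_mfun_affine].
rewrite -!cubeintZ -?cubeintD -?cubeintB;
  try (by apply: bm => //; case: Cf Cg => ? ? []);
  try (by apply: bounded_mfunZ; apply: bm => //; case: Cf Cg => ? ? []).
rewrite (cubeint_slice t); last first.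
  by apply: bounded_mfunD; apply: bounded_mfunZ; apply: bm => //; case: Cf Cg => ? ? [].
apply: eq_cubeint => y _.
pose c := affine (col' t a) r1 y; pose d := affine (col' t b) r2 y.
have E (e : 'rV[R]_n.+1) r x : affine e r (tinsert t x y) =
    e 0 t * x + affine (col' t e) r y.
  by rewrite affine_tinsert /affine addrCA.
have C := C1_mul (C1_affine (a 0 t) c Cf) (C1_affine (b 0 t) d Cg).
transitivity (\int[mu]_(x in `[0, 1])
   (a 0 t * f' (a 0 t * x + c) * g (b 0 t * x + d) +
    f (a 0 t * x + c) * (b 0 t * g' (b 0 t * x + d)))).
  by apply: eq_Rintegral => x _; rewrite !E -/c -/d; ring.
rewrite (Rintegral_C1 ler01 C)/= !mulr1 !mulr0 !add0r.
have E' (e : 'rV[R]_n.+1) r : affine (col' t e) (e 0 t + r) y =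
    e 0 t + affine (col' t e) r y by rewrite /affine addrCA.
by rewrite !E'.
Qed.

(** Along a direction parallel to g1 = 0 the terms with f' cancel; hence f may
    tend to a step function. *)
Lemma cubeint_tangent_C1 n (a b : 'rV[R]_n.+1) r1 r2 (s t : 'I_n.+1)
    (f f' g g' : R -> R) :
  C1 f f' -> C1 g g' ->
  minor a b s t * cubeint (fun x => f (affine a r1 x) * g' (affine b r2 x)) =
  a 0 s * (cubeint (fun y => f (affine (col' t a) (a 0 t + r1) y) *
                    g (affine (col' t b) (b 0 t + r2) y)) -
  cubeint (fun y => f (affine (col' t a) r1 y) * g (affine (col' t b) r2 y)))
  - a 0 t * (cubeint (fun y => f (affine (col' s a) (a 0 s + r1) y) *
                    g (affine (col' s b) (b 0 s + r2) y)) -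
  cubeint (fun y => f (affine (col' s a) r1 y) * g (affine (col' s b) r2 y))).
Proof.
by move=> Cf Cg; rewrite -!(cubeint_derive_facets a b r1 r2 _ Cf Cg) minorE; ring.
Qed.

Lemma cvg_cubeint n (f_ : nat -> n.-tuple R -> R) (f : n.-tuple R -> R) M :
  (forall m, bounded_mfun (f_ m)) -> bounded_mfun f ->
  (forall m x, cube n x -> `|f_ m x| <= M) ->
  (forall x, cube n x -> f_ ^~ x @ \oo --> f x) ->
  cubeint (f_ m) @[m --> \oo] --> cubeint f.
Proof.
move=> bf_ bf fM f_f.
have [//||||||_ _ h] := @dominated_convergence _ (n.-tuple T) R (lebesgue_tuple n)
  (cube n : set (n.-tuple T)) _ (fun m x => (f_ m x)%:E) (fun x => (f x)%:E) (fun=> M%:E).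
- exact: measurable_cube.
- by move=> m; apply/measurable_EFinP/measurable_funTS; case: (bf_ m).
- by apply/measurable_EFinP/measurable_funTS; case: bf.
- apply: aeW => x cx; apply/fine_cvgP; split; first exact: nearW.
  exact: f_f.
- exact: (bounded_mfun_integrable (bounded_mfun_cst n M)).
- by apply: aeW => x m cx; rewrite lee_fin; exact: fM.
rewrite /cubeint /Rintegral; apply: fine_cvg; rewrite fineK//.
by apply: integrable_fin_num; [exact: measurable_cube|exact: bounded_mfun_integrable].
Qed.

Lemma truncpow_le0 N (y : R) : y <= 0 -> truncpow N y = 0.
Proof. by move=> y0; rewrite /truncpow ltNge y0. Qed.

Lemma locbounded_nneg : locbounded_mfun (fun y : R => (0 <= y)%R%:R).
Proof.
split; last by move=> K; exists 1 => y _; case: (0 <= y); rewrite ?normr1 ?normr0.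
rewrite (_ : (fun _ => _) = \1_`[0, +oo[%classic); first exact: measurable_indic.
by apply/funext => y; rewrite indicE mem_setE in_itv/= andbT.
Qed.

Lemma locbounded_truncpow k : locbounded_mfun (@truncpow R k).
Proof.
case: k => [|k]; last by apply: continuous_locbounded; exact: continuous_truncpow.
split; last by move=> K; exists 1 => y _; rewrite /truncpow; case: ifP;
  rewrite ?normr0 ?expr0 ?fact0 ?divr1 ?normr1.
rewrite (_ : truncpow 0 = \1_`]0, +oo[%classic); first exact: measurable_indic.
apply/funext => y; rewrite indicE mem_setE in_itv/= andbT /truncpow.
by case: ifP => // _; rewrite expr0 fact0 divr1.
Qed.

Definition clipint n (a b : 'rV[R]_n) (r1 r2 : R) k : R :=
  cubeint (fun x => (0 <= affine a r1 x)%R%:R * truncpow k (affine b r2 x)).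

Lemma bounded_mfun_clip n (a b : 'rV[R]_n) r1 r2 k :
  bounded_mfun (fun x => (0 <= affine a r1 x)%R%:R * truncpow k (affine b r2 x)).
Proof.
apply: bounded_mfunM; last first.
  by apply: bounded_mfun_comp; [exact: locbounded_truncpow|exact: bounded_mfun_affine].
by apply: (bounded_mfun_comp locbounded_nneg); exact: bounded_mfun_affine.
Qed.

Lemma truncpow_ge0 j (y : R) : 0 <= truncpow j y.
Proof. by rewrite /truncpow; case: ifP => // y0; rewrite divr_ge0// exprn_ge0// ltW. Qed.

(** The approximations are 1 / (1 + m truncpow 2 (- y)): they equal 1 for y >= 0
    and tend to 0 for y < 0. *)
Lemma approx_nneg : exists f f' : nat -> R -> R,
  [/\ forall m, C1 (f m) (f' m), forall m y, `|f m y| <= 1 &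
      forall y, f ^~ y @ \oo --> ((0 <= y)%R%:R : R)].
Proof.
pose q (m : nat) (y : R) : R := 1 + m%:R * truncpow 2 (-1 * y + 0).
pose q' (m : nat) (y : R) : R := 0 + m%:R * (-1 * truncpow 1 (-1 * y + 0)).
have q1 m y : 1 <= q m y by rewrite lerDl mulr_ge0// truncpow_ge0.
have q0 m y : 0 < q m y by exact: lt_le_trans (q1 _ _).
have Cq m : C1 (q m) (q' m).
  by apply: C1_add; [exact: C1_cst|apply: C1_scale; apply: C1_affine; exact: C1_truncpow].
exists (fun m y => (q m y)^-1), (fun m y => - ((q m y)^-1 * (q m y)^-1) * q' m y).
split=> [m|m y|y].
- by apply: C1_inv => // y; rewrite gt_eqF.
- by rewrite ger0_norm ?invr_ge0 ?(ltW (q0 _ _))// invf_le1.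
have [y0|y0] := leP 0 y.
  rewrite (_ : (fun m => _) = cst 1); first exact: cvg_cst.
  apply/funext => m; rewrite /q /truncpow mulN1r addr0 oppr_gt0 ltNge y0/=.
  by rewrite mulr0 addr0 invr1.
apply/cvgrPdist_lt => e e0; near=> m.
rewrite sub0r normrN ger0_norm ?invr_ge0 ?(ltW (q0 _ _))// invf_plt ?posrE//.
rewrite /q mulN1r addr0; set c := truncpow _ _.
have c0 : 0 < c by rewrite /c /truncpow oppr_gt0 y0 divr_gt0// exprn_gt0// oppr_gt0.
rewrite ltr_wpDl// -ltr_pdivrMr//; near: m.
exact: nbhs_infty_gtr.
Unshelve. all: by end_near. Qed.

(** For k >= 1 the function truncpow (k + 1) is itself of class C^1. For k = 0
    the difference quotients of truncpow 2 with step 1 / (m + 1) are used; they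
    are taken backwards so that the limit of the derivatives at y = 0 is 0, the
    value of truncpow 0 there. *)
Lemma approx_truncpow k : exists g g' : nat -> R -> R,
  [/\ forall m, C1 (g m) (g' m),
      forall K, exists M, forall m y, `|y| <= K -> `|g m y| <= M /\ `|g' m y| <= M,
      forall y, g ^~ y @ \oo --> truncpow k.+1 y &
      forall y, g' ^~ y @ \oo --> truncpow k y].
Proof.
case: k => [|k]; last first.
  exists (fun _ => truncpow k.+2), (fun _ => truncpow k.+1).
  split=> [m|K|y|y]; [exact: C1_truncpow| |exact: cvg_cst|exact: cvg_cst].
  have [_ /(_ K)[M1 h1]] := locbounded_truncpow k.+2.
  have [_ /(_ K)[M2 h2]] := locbounded_truncpow k.+1.
  by exists (Num.max M1 M2) => _ y yK; rewrite !le_max h1// h2// orbT.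
pose e (m : nat) : R := m.+1%:R^-1.
have e0 m : 0 < e m by rewrite invr_gt0.
pose g (m : nat) (y : R) : R :=
  m.+1%:R * (truncpow 2 y + (-1) * truncpow 2 (1 * y + - e m)).
pose g' (m : nat) (y : R) : R :=
  m.+1%:R * (truncpow 1 y + (-1) * (1 * truncpow 1 (1 * y + - e m))).
(* Three regimes: both arguments nonpositive, only the shifted one, neither. *)
have gE m y : (y <= 0 -> g m y = 0) /\ (y <= 0 -> g' m y = 0) /\
    (0 < y <= e m -> g m y = m.+1%:R * y * y / 2) /\
    (0 < y <= e m -> g' m y = m.+1%:R * y) /\
    (e m < y -> g m y = y - e m / 2) /\ (e m < y -> g' m y = 1).
  have me : m.+1%:R * e m = 1 by rewrite mulfV// pnatr_eq0.
  have em := e0 m.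
  rewrite /g /g' /truncpow !expr2 !expr1 !factS fact0 !muln1 mul1r !divr1 subr_gt0.
  split; [|split; [|split; [|split; [|split]]]].
  - by move=> y0; rewrite (ltNge 0 y) y0 (ltNge (e m)) (le_trans y0 (ltW em))/=; ring.
  - by move=> y0; rewrite (ltNge 0 y) y0 (ltNge (e m)) (le_trans y0 (ltW em))/=; ring.
  - by move=> /andP[y0 ye]; rewrite y0 ltNge ye/=; field.
  - by move=> /andP[y0 ye]; rewrite y0 ltNge ye/=; ring.
  - move=> ey; rewrite ey (lt_trans em ey).
    transitivity ((m.+1%:R * e m) * (y - e m / 2)); last by rewrite me mul1r.
    by field.
  - move=> ey; rewrite ey (lt_trans em ey).
    by transitivity (m.+1%:R * e m) => //; ring.
exists g, g'; split=> [m|K|y|y].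
- apply: C1_scale; apply: C1_add; first exact: C1_truncpow.
  by apply: C1_scale; apply: C1_affine; exact: C1_truncpow.
- exists (`|K| + 1) => m y yK; have [g0 [g'0 [g1 [g'1 [g2 g'2]]]]] := gE m y.
  have em := e0 m.
  have me : m.+1%:R * e m = 1 by rewrite mulfV// pnatr_eq0.
  have K0 : 0 <= K by exact: le_trans yK.
  rewrite (ger0_norm K0).
  have yK' : y <= K by exact: le_trans (ler_norm _) yK.
  have [y0|y0] := leP y 0; first by rewrite g0// g'0// normr0 addr_ge0.
  have [ye|ye] := leP y (e m); last first.
    by rewrite g2// g'2// normr1 ger0_norm; lra.
  have my : m.+1%:R * y <= 1.
    by apply: (@le_trans _ _ (m.+1%:R * e m)); [rewrite ler_pM2l|rewrite me].
  have my0 : 0 <= m.+1%:R * y by rewrite mulr_ge0// ltW.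
  rewrite g1 ?y0// g'1 ?y0//; split; rewrite ger0_norm//; [|nra|lra].
  by nra.
- have [y0|y0] := leP y 0.
    rewrite (_ : (fun m => _) = cst 0).
      by rewrite /truncpow ltNge y0/=; exact: cvg_cst.
    by apply/funext => m; have [-> ] := gE m y.
  have ce : e @ \oo --> (0 : R) by exact: cvg_harmonic.
  have : (fun m => y - e m / 2) @ \oo --> truncpow 1 y.
    rewrite /truncpow y0 expr1 factS fact0 muln1 divr1 -[X in _ --> X]subr0.
    apply: cvgB; first exact: cvg_cst.
    rewrite -(mul0r (2^-1 : R)); apply: cvgM => //; exact: cvg_cst.
  apply: cvg_trans; apply: near_eq_cvg; near=> m.
  have [_ [_ [_ [_ [-> //]]]]] := gE m y.
  by near: m; exact: (cvgr_lt _ ce).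
- have [y0|y0] := leP y 0.
    rewrite (_ : (fun m => _) = cst 0).
      by rewrite /truncpow ltNge y0/=; exact: cvg_cst.
    by apply/funext => m; have [_ [-> ]] := gE m y.
  have ce : e @ \oo --> (0 : R) by exact: cvg_harmonic.
  have : (fun m => 1) @ \oo --> truncpow 0 y.
    by rewrite /truncpow y0 expr0 fact0 divr1; exact: cvg_cst.
  apply: cvg_trans; apply: near_eq_cvg; near=> m.
  have [_ [_ [_ [_ [_ -> //]]]]] := gE m y.
  by near: m; exact: (cvgr_lt _ ce).
Unshelve. all: by end_near. Qed.

End clipped.

(** * Passage to the limit: recursions over the facets *)

Section limits.
Context {R : realType}.
Local Notation T := (measurableTypeR R).
Local Notation mu := (@lebesgue_measure R).

(** The shape shared by the recursions below: a multiple of one integral equals a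
    combination of two differences. *)
Lemma eq_lim_lincomb (x y1 y0 z1 z0 : nat -> R) (lx ly1 ly0 lz1 lz0 p q r : R) :
  x @ \oo --> lx -> y1 @ \oo --> ly1 -> y0 @ \oo --> ly0 ->
  z1 @ \oo --> lz1 -> z0 @ \oo --> lz0 ->
  (forall m, p * x m = q * (y1 m - y0 m) - r * (z1 m - z0 m)) ->
  p * lx = q * (ly1 - ly0) - r * (lz1 - lz0).
Proof.
move=> cx cy1 cy0 cz1 cz0 E.
have cL : p * x m @[m --> \oo] --> p * lx by apply: cvgM => //; exact: cvg_cst.
have cR : q * (y1 m - y0 m) - r * (z1 m - z0 m) @[m --> \oo] -->
    q * (ly1 - ly0) - r * (lz1 - lz0).
  by apply: cvgB; (apply: cvgM; [exact: cvg_cst|exact: cvgB]).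
apply: (cvg_unique _ cL) => //; apply: cvg_trans cR; apply: near_eq_cvg.
by apply: nearW => m; rewrite E.
Qed.

Lemma cvg_cubeint_prod n (a b : 'rV[R]_n) r1 r2 (f_ g_ : nat -> R -> R) (f g : R -> R) :
  (forall m, continuous (f_ m)) -> (forall m, continuous (g_ m)) ->
  locbounded_mfun f -> locbounded_mfun g ->
  (forall m y, `|f_ m y| <= 1) ->
  (forall K, exists M, forall m y, `|y| <= K -> `|g_ m y| <= M) ->
  (forall y, f_ ^~ y @ \oo --> f y) -> (forall y, g_ ^~ y @ \oo --> g y) ->
  cubeint (fun x => f_ m (affine a r1 x) * g_ m (affine b r2 x)) @[m --> \oo] -->
  cubeint (fun x => f (affine a r1 x) * g (affine b r2 x)).
Proof.
move=> cf cg lf lg f1 gM ff gg.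
have [_ [K bK]] := bounded_mfun_affine b r2; have [M gMK] := gM K.
have bm (u v : R -> R) : locbounded_mfun u -> locbounded_mfun v ->
    bounded_mfun (fun x => u (affine a r1 x) * v (affine b r2 x)).
  move=> lu lv; have ba := @bounded_mfun_affine R n.
  by apply: bounded_mfunM; [exact: (bounded_mfun_comp lu)|exact: (bounded_mfun_comp lv)].
apply: (@cvg_cubeint _ _ _ _ M).
- by move=> m; apply: bm; exact: continuous_locbounded.
- exact: bm.
- move=> m x cx; rewrite normrM -[M]mul1r; apply: ler_pM => //.
  by apply: gMK; exact: bK.
- by move=> x _; apply: cvgM; [exact: ff|exact: gg].
Qed.

(** The divergence theorem on the clipped cube along a_s e_t - a_t e_s. *)
Lemma clipint_facets n (a b : 'rV[R]_n.+1) r1 r2 (s t : 'I_n.+1) k :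
  minor a b s t * clipint a b r1 r2 k =
  a 0 s * (clipint (col' t a) (col' t b) (a 0 t + r1) (b 0 t + r2) k.+1 -
           clipint (col' t a) (col' t b) r1 r2 k.+1)
  - a 0 t * (clipint (col' s a) (col' s b) (a 0 s + r1) (b 0 s + r2) k.+1 -
             clipint (col' s a) (col' s b) r1 r2 k.+1).
Proof.
have [f_ [f_' [Cf f1 ff]]] := @approx_nneg R.
have [g_ [g_' [Cg gM gg gg']]] := @approx_truncpow R k.
have cf m := C1_continuous (Cf m); have cg m := C1_continuous (Cg m).
have cg' m : continuous (g_' m) by case: (Cg m).
have gM1 K : exists M, forall m y, `|y| <= K -> `|g_ m y| <= M.
  by have [M h] := gM K; exists M => m y yK; case: (h m y yK).
have gM2 K : exists M, forall m y, `|y| <= K -> `|g_' m y| <= M.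
  by have [M h] := gM K; exists M => m y yK; case: (h m y yK).
have lim m (c d : 'rV[R]_m) e h := @cvg_cubeint_prod m c d e h f_ g_ _ _ cf cg
  locbounded_nneg (locbounded_truncpow k.+1) f1 gM1 ff gg.
have lim' := @cvg_cubeint_prod _ a b r1 r2 f_ g_' _ _ cf cg'
  locbounded_nneg (locbounded_truncpow k) f1 gM2 ff gg'.
apply: (eq_lim_lincomb lim' (lim _ _ _ _ _) (lim _ _ _ _ _)
  (lim _ _ _ _ _) (lim _ _ _ _ _)).
by move=> m; exact: cubeint_tangent_C1.
Qed.

(** Without the first clip there is no hyperplane to avoid, and the coordinate
    direction t can be used. *)
Lemma cubeint_truncpow_facets n (b : 'rV[R]_n.+1) r2 (t : 'I_n.+1) k :
  b 0 t * cubeint (fun x => truncpow k (affine b r2 x)) =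
  cubeint (fun x => truncpow k.+1 (affine (col' t b) (b 0 t + r2) x)) -
  cubeint (fun x => truncpow k.+1 (affine (col' t b) r2 x)).
Proof.
have [g_ [g_' [Cg gM gg gg']]] := @approx_truncpow R k.
have cg m := C1_continuous (Cg m); have cg' m : continuous (g_' m) by case: (Cg m).
have gM1 K : exists M, forall m y, `|y| <= K -> `|g_ m y| <= M.
  by have [M h] := gM K; exists M => m y yK; case: (h m y yK).
have gM2 K : exists M, forall m y, `|y| <= K -> `|g_' m y| <= M.
  by have [M h] := gM K; exists M => m y yK; case: (h m y yK).
have c1 (m : nat) : continuous (fun _ : R => 1 : R) by move=> x; exact: cvg_cst.
have n1 (m : nat) (y : R) : `|1 : R| <= 1 by rewrite normr1.
have l1 (y : R) : (fun m : nat => 1 : R) @ \oo --> (1 : R) by exact: cvg_cst.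
have lim m (d : 'rV[R]_m) h := @cvg_cubeint_prod m 0 d 0 h (fun _ _ => 1) g_ _ _ c1 cg
  (continuous_locbounded (c1 0)) (locbounded_truncpow k.+1) n1 gM1 l1 gg.
have lim' := @cvg_cubeint_prod _ 0 b 0 r2 (fun _ _ => 1) g_' _ _ c1 cg'
  (continuous_locbounded (c1 0)) (locbounded_truncpow k) n1 gM2 l1 gg'.
have E1 m (u : m.-tuple R -> R) : cubeint (fun x => 1 * u x) = cubeint u.
  by apply: eq_cubeint => x _; rewrite mul1r.
have l0 : (fun _ : nat => 0 : R) @ \oo --> (0 : R) by exact: cvg_cst.
have := eq_lim_lincomb (p := b 0 t) (q := 1) (r := 0) lim'
  (lim _ (col' t b) (b 0 t + r2)) (lim _ (col' t b) r2) l0 l0.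
rewrite !E1 mul1r mul0r subr0; apply=> m.
rewrite mul1r subr0; have := cubeint_derive_facets 0 b 0 r2 t (C1_cst 1) (Cg m).
by rewrite mxE mul0r add0r => ->.
Qed.

Lemma Rintegral_truncpow (b d l u : R) k : l <= u ->
  b * \int[mu]_(x in `[l, u]) truncpow k (b * x + d) =
  truncpow k.+1 (b * u + d) - truncpow k.+1 (b * l + d).
Proof.
move=> lu; have [g_ [g_' [Cg gM gg gg']]] := @approx_truncpow R k.
have CA m := C1_affine b d (Cg m).
pose K := `|b| * (`|l| + `|u|) + `|d|.
have [M gMK] := gM K.
have bK x : x \in `[l, u] -> `|b * x + d| <= K.
  rewrite in_itv/= => /andP[lx xu]; apply: (le_trans (ler_normD _ _)).
  rewrite lerD2r normrM ler_wpM2l// ler_norml.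
  have := ler_norm u; have := ler_norm (- l); rewrite normrN => h1 h2.
  by have := normr_ge0 l; have := normr_ge0 u => h3 h4; apply/andP; split; lra.
have mg m : measurable_fun [set: T] (fun x => g_' m (b * x + d)).
  have [_ cg'] := Cg m.
  apply: continuous_measurable_fun => x.
  apply: (@continuous_comp _ _ _ (fun x => b * x + d)); last exact: cg'.
  by apply: cvgD; [apply: cvgM; [exact: cvg_cst|exact: cvg_id]|exact: cvg_cst].
have mh : measurable_fun [set: T] (fun x => truncpow k (b * x + d)).
  apply: (@measurableT_comp _ _ _ _ _ _ (truncpow k)).
    by case: (@locbounded_truncpow R k).
  by apply: measurable_funD => //; apply: measurable_funM.
have [//||||||_ _ h] := @dominated_convergence _ T R mu `[l, u]%classic _
  (fun m x => (g_' m (b * x + d))%:E) (fun x => (truncpow k (b * x + d))%:E) (fun=> M%:E).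
- by move=> m; apply/measurable_EFinP/measurable_funTS; exact: mg.
- by apply/measurable_EFinP/measurable_funTS; exact: mh.
- by apply: aeW => x cx; apply/fine_cvgP; split; [exact: nearW|exact: gg'].
- by apply: (@bounded_integrable_itv _ _ _ _ `|M|) => //; exact: measurable_cst.
- by apply: aeW => x m /bK cx; rewrite lee_fin; case: (gMK m _ cx).
have ih : mu.-integrable `[l, u] (EFin \o (fun x => truncpow k (b * x + d))).
  have [_ /(_ K)[N hN]] := @locbounded_truncpow R k.
  apply: (@bounded_integrable_itv _ _ _ _ N) => // x xlu; apply: hN; apply: bK.
  by rewrite in_itv.
have lim : \int[mu]_(x in `[l, u]) g_' m (b * x + d) @[m --> \oo] -->
    \int[mu]_(x in `[l, u]) truncpow k (b * x + d).
  apply: fine_cvg; rewrite fineK//; exact: integrable_fin_num.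
have l0 : (fun _ : nat => 0 : R) @ \oo --> (0 : R) by exact: cvg_cst.
have := eq_lim_lincomb (p := b) (q := 1) (r := 0) lim
  (gg (b * u + d)) (gg (b * l + d)) l0 l0.
rewrite mul1r mul0r subr0; apply=> m.
rewrite mul1r subr0 -(Rintegral_C1 lu (CA m))// RintegralZl//.
apply: (@bounded_integrable_itv _ _ _ _ M) => // x xlu.
by case: (gMK m (b * x + d)) => //; apply: bK; rewrite in_itv.
Qed.

Lemma cubeint_dim0 (f : 0.-tuple R -> R) : cubeint f = f [tuple].
Proof.
by rewrite -[RHS](cubeint_cst 0); apply: eq_cubeint => x _; rewrite (tuple0 x).
Qed.

End limits.

(** * Vertex and edge sums *)

Section combinatorics.
Context {R : realType}.
Implicit Types (n N k : nat) (r : R).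

(** Vertices are indexed by boolean tuples so that sums over them are finite. *)
Definition vertex n (w : n.-tuple bool) : n.-tuple R :=
  [tuple (tnth w i)%:R | i < n].

Definition vertex_sign n (w : n.-tuple bool) : R :=
  \prod_(i < n) (if tnth w i then 1 else -1).

Local Notation aff a r w := (affine a r (vertex w)).

Lemma vertex_tinsert n (t : 'I_n.+1) (e : bool) (w : n.-tuple bool) :
  vertex (tinsert t e w) = tinsert t e%:R (vertex w).
Proof.
apply: eq_from_tnth => i; rewrite tnth_mktuple; have [j ->|->] := unliftP t i.
  by rewrite !tnth_tinsert_lift tnth_mktuple.
by rewrite !tnth_tinsert.
Qed.

Lemma affine_vertex_tinsert n (a : 'rV[R]_n.+1) r (t : 'I_n.+1) (e : bool)
    (w : n.-tuple bool) :
  aff a r (tinsert t e w) = aff (col' t a) (a 0 t * e%:R + r) w.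
Proof. by rewrite vertex_tinsert affine_tinsert. Qed.

Lemma vertex_sign_tinsert n (t : 'I_n.+1) (e : bool) (w : n.-tuple bool) :
  vertex_sign (tinsert t e w) = (if e then 1 else -1) * vertex_sign w.
Proof.
rewrite /vertex_sign (bigD1_ord t)//= tnth_tinsert; congr (_ * _).
by apply: eq_bigr => j _; rewrite tnth_tinsert_lift.
Qed.

Lemma minor_lift n (a b : 'rV[R]_n.+1) (t : 'I_n.+1) (i j : 'I_n) :
  minor (col' t a) (col' t b) i j = minor a b (lift t i) (lift t j).
Proof. by rewrite !minorE !mxE. Qed.

(** The factor truncpow discards the vertices with g2 <= 0. *)
Definition vertex_sum n (a b : 'rV[R]_n) r1 r2 N : R :=
  \sum_(w : n.-tuple bool | 0 <= aff a r1 w)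
    vertex_sign w * truncpow N (aff b r2 w) / \prod_(t < n) b 0 t.

(** The edge of direction m is given by its endpoint w with w_m = 1; the value of
    g1 at the other endpoint is g1(w) - a_m. A negative product says that the
    hyperplane g1 = 0 meets the interior of the edge in one point. *)
Definition clipped_edge n (a : 'rV[R]_n) r1 (m : 'I_n) (w : n.-tuple bool) : bool :=
  tnth w m && (aff a r1 w * (aff a r1 w - a 0 m) < 0).

Lemma clipped_edge_neq0 n (a : 'rV[R]_n) r1 m w :
  clipped_edge a r1 m w -> a 0 m != 0.
Proof.
move=> /andP[_ h]; apply/eqP => a0; move: h.
by rewrite a0 subr0 -expr2 ltNge sqr_ge0.
Qed.

(** The value of g2 at the point of the edge where g1 = 0. *)
Definition edge_value n (a b : 'rV[R]_n) r1 r2 (m : 'I_n) (w : n.-tuple bool) : R :=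
  aff b r2 w - b 0 m / a 0 m * aff a r1 w.

Definition edge_sum n (a b : 'rV[R]_n) r1 r2 N : R :=
  \sum_(m < n) \sum_(w : n.-tuple bool | clipped_edge a r1 m w)
    vertex_sign w * a 0 m ^+ n * truncpow N (edge_value a b r1 r2 m w) /
    (`|a 0 m| * b 0 m * \prod_(t < n | t != m) minor a b m t).

(** The good clipping conditions in terms of boolean tuples, in a form that passes
    to facets, where the coefficient vectors may vanish. *)
Record good_clipping n (a b : 'rV[R]_n) r1 r2 : Prop := GoodClipping {
  good_vertex : forall w, 0 < aff b r2 w -> aff a r1 w != 0;
  good_vertex_coeff : forall w, 0 <= aff a r1 w -> 0 < aff b r2 w ->
    forall t, b 0 t != 0;
  good_edge : forall m w, clipped_edge a r1 m w -> 0 < edge_value a b r1 r2 m w ->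
    b 0 m != 0 /\ forall t, t != m -> minor a b m t != 0 }.

Lemma clipped_edge_tinsert n (a : 'rV[R]_n.+1) r1 (t : 'I_n.+1) (e : bool) m
    (w : n.-tuple bool) :
  clipped_edge (col' t a) (a 0 t * e%:R + r1) m w =
  clipped_edge a r1 (lift t m) (tinsert t e w).
Proof. by rewrite /clipped_edge tnth_tinsert_lift affine_vertex_tinsert mxE. Qed.

Lemma edge_value_tinsert n (a b : 'rV[R]_n.+1) r1 r2 (t : 'I_n.+1) (e : bool) m
    (w : n.-tuple bool) :
  edge_value (col' t a) (col' t b) (a 0 t * e%:R + r1) (b 0 t * e%:R + r2) m w =
  edge_value a b r1 r2 (lift t m) (tinsert t e w).
Proof. by rewrite /edge_value !affine_vertex_tinsert !mxE. Qed.

Lemma good_clipping_facet n (a b : 'rV[R]_n.+1) r1 r2 (t : 'I_n.+1) (e : bool) :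
  good_clipping a b r1 r2 ->
  good_clipping (col' t a) (col' t b) (a 0 t * e%:R + r1) (b 0 t * e%:R + r2).
Proof.
move=> [gA gB1 gB2]; split=> [w|w|m w].
- by rewrite -!affine_vertex_tinsert; exact: gA.
- by rewrite -!affine_vertex_tinsert => h1 h2 j; rewrite mxE; exact: (gB1 _ h1 h2).
- rewrite clipped_edge_tinsert edge_value_tinsert => h1 h2.
  have [h3 h4] := gB2 _ _ h1 h2.
  split=> [|j jm]; first by rewrite mxE.
  by rewrite minor_lift; apply: h4; rewrite (inj_eq lift_inj).
Qed.

(** A vertex of the cube lies on exactly one of the two facets x_t = 0, 1. The
    minus sign of the facet x_t = 0 is the sign of the additional zero, and
    b_t / prod b is the inverse product over the other coordinates. *)
Lemma facet_vertex_sum n (a b : 'rV[R]_n.+1) r1 r2 N (t : 'I_n.+1) :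
  (forall w, 0 <= aff a r1 w -> 0 < aff b r2 w -> forall t, b 0 t != 0) ->
  vertex_sum (col' t a) (col' t b) (a 0 t * true%:R + r1) (b 0 t * true%:R + r2) N -
  vertex_sum (col' t a) (col' t b) (a 0 t * false%:R + r1) (b 0 t * false%:R + r2) N =
  \sum_(w : n.+1.-tuple bool | 0 <= aff a r1 w)
    b 0 t * (vertex_sign w * truncpow N (aff b r2 w) / \prod_(t < n.+1) b 0 t).
Proof.
move=> gB1; rewrite (big_tinsert _ t) /vertex_sum -sumrN.
have key e (w : n.-tuple bool) : 0 <= aff a r1 (tinsert t e w) ->
   b 0 t * (vertex_sign (tinsert t e w) * truncpow N (aff b r2 (tinsert t e w)) /
     \prod_(t < n.+1) b 0 t) =
   (if e then 1 else -1) *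
   (vertex_sign w * truncpow N (aff b r2 (tinsert t e w)) /
     \prod_(j < n) col' t b 0 j).
  move=> h1; rewrite vertex_sign_tinsert.
  have [h2|h2] := leP (aff b r2 (tinsert t e w)) 0.
    by rewrite truncpow_le0// !(mulr0, mul0r).
  have b0 := gB1 _ h1 h2.
  rewrite (bigD1_ord t)//=; under [in RHS]eq_bigr do rewrite mxE.
  have : \prod_(j < n) b 0 (lift t j) != 0 by apply/prodf_neq0 => j _; exact: b0.
  by move=> p0; field; rewrite p0 b0.
congr (_ + _).
  apply: eq_big => [w|w]; rewrite -(affine_vertex_tinsert a r1 t true)// => h1.
  by rewrite -(affine_vertex_tinsert b r2 t true) key// mul1r.
apply: eq_big => [w|w]; rewrite -(affine_vertex_tinsert a r1 t false)// => h1.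
by rewrite -(affine_vertex_tinsert b r2 t false) key// mulN1r.
Qed.

Lemma minorxx n (a b : 'rV[R]_n) m : minor a b m m = 0.
Proof. by rewrite minorE mulrC subrr. Qed.

(** An edge of direction m lies on one of the two facets x_t = 0, 1 if m != t,
    and on neither if m = t; in the latter case minor m t = 0, so that edges of
    all directions can be kept on the right. The facet has one factor a_m and the
    factor minor m t fewer than the cube. *)
Lemma facet_edge_sum n (a b : 'rV[R]_n.+1) r1 r2 N (t : 'I_n.+1) :
  (forall m w, clipped_edge a r1 m w -> 0 < edge_value a b r1 r2 m w ->
    b 0 m != 0 /\ forall t, t != m -> minor a b m t != 0) ->
  edge_sum (col' t a) (col' t b) (a 0 t * true%:R + r1) (b 0 t * true%:R + r2) N -
  edge_sum (col' t a) (col' t b) (a 0 t * false%:R + r1) (b 0 t * false%:R + r2) N =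
  \sum_(m < n.+1) \sum_(w : n.+1.-tuple bool | clipped_edge a r1 m w)
    minor a b m t *
    (vertex_sign w * a 0 m ^+ n * truncpow N (edge_value a b r1 r2 m w) /
    (`|a 0 m| * b 0 m * \prod_(t < n.+1 | t != m) minor a b m t)).
Proof.
move=> gB2; rewrite (bigD1_ord t)//= [X in _ = X + _]big1 ?add0r; last first.
  by move=> w _; rewrite minorxx mul0r.
rewrite /edge_sum -sumrB; apply: eq_bigr => m _.
rewrite (big_tinsert _ t) -sumrN.
have key e (w : n.-tuple bool) : clipped_edge a r1 (lift t m) (tinsert t e w) ->
   minor a b (lift t m) t * (vertex_sign (tinsert t e w) * a 0 (lift t m) ^+ n *
     truncpow N (edge_value a b r1 r2 (lift t m) (tinsert t e w)) /
    (`|a 0 (lift t m)| * b 0 (lift t m) *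
      \prod_(j < n.+1 | j != lift t m) minor a b (lift t m) j)) =
   (if e then 1 else -1) *
   (vertex_sign w * col' t a 0 m ^+ n *
     truncpow N (edge_value a b r1 r2 (lift t m) (tinsert t e w)) /
    (`|col' t a 0 m| * col' t b 0 m *
      \prod_(j < n | j != m) minor (col' t a) (col' t b) m j)).
  move=> h1; rewrite vertex_sign_tinsert.
  set c := edge_value _ _ _ _ _ _.
  have [h2|h2] := leP c 0; first by rewrite truncpow_le0// !(mulr0, mul0r).
  have [b0 m0] := gB2 _ _ h1 h2.
  have a0 : `|a 0 (lift t m)| != 0 by rewrite normr_eq0 (clipped_edge_neq0 h1).
  rewrite (bigD1 t) ?neq_lift//= !mxE.
  under eq_bigl do rewrite andbC.
  rewrite big_lift.
  rewrite (eq_bigl (fun j => j != m)); last by move=> j; rewrite (inj_eq lift_inj).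
  under [in RHS]eq_bigr do rewrite minor_lift.
  set p := \prod_(j < n | _) _.
  have p0 : p != 0.
    by apply/prodf_neq0 => j jm; apply: m0; rewrite (inj_eq lift_inj).
  have mt := m0 t (neq_lift _ _).
  move: (minor a b (lift t m) t) (`|a 0 (lift t m)|) mt a0 => u v u0 v0.
  by field; rewrite u0 v0 b0 p0.
congr (_ + _).
  apply: eq_big => [w|w]; rewrite (clipped_edge_tinsert a r1 t true)// => h1.
  by rewrite (edge_value_tinsert a b r1 r2 t true) key// mul1r.
apply: eq_big => [w|w]; rewrite (clipped_edge_tinsert a r1 t false)// => h1.
by rewrite (edge_value_tinsert a b r1 r2 t false) key// mulN1r.
Qed.

(** Induction along the first coordinate. The sum over the vertices in a single
    halfspace is the vertex sum for the trivial first clip 0 >= 0. *)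
Lemma cubeint_truncpow n (b : 'rV[R]_n) r2 k : (forall t, b 0 t != 0) ->
  cubeint (fun x => truncpow k (affine b r2 x)) = vertex_sum 0 b 0 r2 (n + k).
Proof.
elim: n b r2 k => [|n IHn] b r2 k b0.
  rewrite cubeint_dim0 /vertex_sum big_tuple0 /affine !big_ord0 !add0r lexx.
  by rewrite /vertex_sign big_ord0 mul1r divr1.
apply: (mulfI (b0 ord0)); rewrite cubeint_truncpow_facets.
have b0' : forall t, col' ord0 b 0 t != 0 by move=> t; rewrite mxE.
rewrite !IHn//.
have := @facet_vertex_sum n 0 b 0 r2 (n + k.+1) ord0 (fun _ _ _ => b0).
rewrite (_ : true%:R = 1 :> R)// (_ : false%:R = 0 :> R)//.
rewrite (_ : (0 : 'rV[R]_n.+1) 0 ord0 = 0) ?mxE// !mul0r !mulr1 !mulr0 !add0r.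
have -> : col' ord0 (0 : 'rV[R]_n.+1) = 0 by apply/rowP => i; rewrite !mxE.
by move=> ->; rewrite /vertex_sum mulr_sumr addnS addSn.
Qed.

End combinatorics.

(** * The clipping formula for all exponents *)

Section clipping_formula.
Context {R : realType}.
Implicit Types (n N k : nat) (r : R).
Local Notation mu := (@lebesgue_measure R).
Local Notation aff a r w := (affine a r (vertex w)).

Lemma cube_vertex n (w : n.-tuple bool) : cube n (vertex w : n.-tuple R).
Proof. by move=> i; rewrite tnth_mktuple; case: (tnth w i); rewrite ?lexx ler01. Qed.

Lemma affine_le_vertex n (b : 'rV[R]_n) r2 x : cube n x ->
  exists w, affine b r2 x <= aff b r2 w.
Proof.
move=> cx; exists [tuple (0 < b 0 i) | i < n].
rewrite lerD2r; apply: ler_sum => i _; rewrite !tnth_mktuple.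
have /andP[x0 x1] := cx i; case: ltP => bi; first by rewrite mulr1 ler_piMr// ltW.
by rewrite mulr0 mulr_le0_ge0.
Qed.

(** If x and y were separated, then g2 = l g1 + c with c > 0, so g2 = c > 0 on the
    whole hyperplane g1 = 0, which therefore contains no vertex and clips no edge. Take a
    vertex w with the least value g1(w) >= 0. Changing one coordinate of w cannot
    make g1 smaller, since a smaller value would be negative and the edge would
    be clipped. Hence w minimizes g1 over the cube, against g1(y) < 0. *)
Lemma parallel_clip_covers n (a b : 'rV[R]_n.+1) r1 r2 x y :
  good_clipping a b r1 r2 ->
  (forall s t, minor a b s t = 0) ->
  (forall m w, clipped_edge a r1 m w -> edge_value a b r1 r2 m w <= 0) ->
  cube n.+1 x -> 0 <= affine a r1 x -> 0 < affine b r2 x ->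
  cube n.+1 y -> affine a r1 y < 0 -> 0 < affine b r2 y -> False.
Proof.
move=> [gA _ _] m0 nocross cx x1 x2 cy y1 y2.
have [s as0] : exists s, a 0 s != 0.
  apply: contrapT => /forallNP h.
  have E z : affine a r1 z = r1.
    rewrite /affine big1 ?add0r// => i _.
    by have /negP := h i; rewrite negbK => /eqP ->; rewrite mul0r.
  by move: x1 y1; rewrite !E leNgt => /negP.
pose l := b 0 s / a 0 s; pose c := r2 - l * r1.
have bE t : b 0 t = l * a 0 t.
  have := m0 s t; rewrite minorE => /eqP; rewrite subr_eq0 => /eqP h.
  by apply: (mulfI as0); rewrite h /l; field.
have E z : affine b r2 z = l * affine a r1 z + c.
  rewrite /affine mulrDr mulr_sumr -addrA.
  have -> : l * r1 + c = r2 by rewrite /c; ring.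
  congr (_ + _).
  by apply: eq_bigr => t _; rewrite bE mulrA.
have c0 : 0 < c.
  have [l0|l0] := leP 0 l.
    by move: y2; rewrite E; have := mulr_ge0_le0 l0 (ltW y1); lra.
  by move: x2; rewrite E; have := mulr_le0_ge0 (ltW l0) x1; lra.
have evE m w : a 0 m != 0 -> edge_value a b r1 r2 m w = c.
  by move=> am; rewrite /edge_value E bE; field.
have neq0 w : aff a r1 w != 0.
  apply/eqP => h; have := gA w; rewrite E h mulr0 add0r => /(_ c0).
  by rewrite eqxx.
have [w0 w0x] := affine_le_vertex a r1 cx.
have w00 : 0 <= aff a r1 w0 by exact: le_trans w0x.
case: (@Order.TotalTheory.arg_minP _ R _ w0 (fun w => 0 <= aff a r1 w)
  (fun w => aff a r1 w) w00) => w w1 wmin.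
have {}w1 : 0 < aff a r1 w by rewrite lt_neqAle eq_sym neq0.
have wsign i : if tnth w i then a 0 i <= 0 else 0 <= a 0 i.
  have wE := tinsertK i w; set v := tremove i w in wE.
  have wF e : aff a r1 (tinsert i e v) =
      a 0 i * e%:R + affine (col' i a) r1 (vertex v).
    by rewrite affine_vertex_tinsert /affine addrCA.
  have low e : aff a r1 (tinsert i e v) < aff a r1 w -> aff a r1 (tinsert i e v) < 0.
    by move=> h; rewrite ltNge; apply/negP => /wmin; rewrite leNgt h.
  case: ifPn => wi.
    rewrite leNgt; apply/negP => ai.
    have w2 : aff a r1 w = a 0 i + affine (col' i a) r1 (vertex v).
      by rewrite -wE wF wi mulr1.
    have h : aff a r1 (tinsert i false v) < 0.
      by apply: low; rewrite wF w2 mulr0 add0r ltrDr.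
    have := nocross i w; rewrite evE ?gt_eqF// leNgt c0/=.
    suff cr : clipped_edge a r1 i w by move=> /(_ cr).
    by rewrite /clipped_edge wi/= pmulr_rlt0//; move: h; rewrite wF w2 mulr0; lra.
  rewrite leNgt; apply/negP => ai.
  have w2 : aff a r1 w = affine (col' i a) r1 (vertex v).
    by rewrite -wE wF (negbTE wi) mulr0 add0r.
  have h : aff a r1 (tinsert i true v) < 0.
    by apply: low; rewrite wF w2 mulr1; lra.
  have := nocross i (tinsert i true v); rewrite evE ?lt_eqF// leNgt c0/=.
  suff cr : clipped_edge a r1 i (tinsert i true v) by move=> /(_ cr).
  by rewrite /clipped_edge tnth_tinsert/= nmulr_rlt0// wF mulr1 addrAC subrr add0r -w2.
suff : aff a r1 w <= affine a r1 y by lra.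
rewrite lerD2r; apply: ler_sum => i _; rewrite tnth_mktuple.
have /andP[y0 y1'] := cy i; have := wsign i; case: (tnth w i) => ai.
  by rewrite -subr_ge0 -mulrBr mulr_le0// subr_le0.
by rewrite mulr0 mulr_ge0.
Qed.

(** By parallel_clip_covers the constraint g1 >= 0 holds everywhere, or nowhere,
    on the part of the cube where g2 > 0. *)
Lemma clipint_parallel n (a b : 'rV[R]_n.+1) r1 r2 k :
  good_clipping a b r1 r2 ->
  (forall s t, minor a b s t = 0) ->
  (forall m w, clipped_edge a r1 m w -> edge_value a b r1 r2 m w <= 0) ->
  clipint a b r1 r2 k =
  vertex_sum a b r1 r2 (n.+1 + k) - edge_sum a b r1 r2 (n.+1 + k).
Proof.
move=> g m0 nocross.
have -> : edge_sum a b r1 r2 (n.+1 + k) = 0.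
  rewrite /edge_sum big1// => m _; rewrite big1// => w /nocross h.
  by rewrite truncpow_le0// mulr0 mul0r.
rewrite subr0.
have [[x [cx x1 x2]]|none] := pselect
  (exists x, [/\ cube n.+1 x, 0 <= affine a r1 x & 0 < affine b r2 x]).
  have all y : cube n.+1 y -> 0 < affine b r2 y -> 0 <= affine a r1 y.
    move=> cy y2; rewrite leNgt; apply/negP => y1.
    exact: (parallel_clip_covers g m0 nocross cx x1 x2 cy y1 y2).
  (* A vertex that maximizes g2 gives access to the condition on the b_t. *)
  have [w wx] := affine_le_vertex b r2 cx.
  have w2 : 0 < aff b r2 w by exact: lt_le_trans wx.
  have b0 := good_vertex_coeff g (all _ (cube_vertex w) w2) w2.
  transitivity (cubeint (fun x => truncpow k (affine b r2 x))).
    apply: eq_cubeint => y cy; have [y2|y2] := leP (affine b r2 y) 0.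
      by rewrite truncpow_le0// mulr0.
    by rewrite (all y)// mul1r.
  rewrite cubeint_truncpow// /vertex_sum big_mkcond [RHS]big_mkcond.
  apply: eq_bigr => v _.
  rewrite (_ : 0 <= affine 0 0 _); last first.
    by rewrite /affine big1 ?addr0// => i _; rewrite mxE mul0r.
  have [v2|v2] := leP (aff b r2 v) 0.
    by rewrite truncpow_le0// mulr0 mul0r if_same.
  by rewrite all//; exact: cube_vertex.
transitivity (cubeint (fun _ : n.+1.-tuple R => 0 : R)).
  apply: eq_cubeint => x cx.
  have [x1|x1] := leP 0 (affine a r1 x); last by rewrite mul0r.
  by rewrite truncpow_le0 ?mulr0// leNgt; apply/negP => x2; apply: none; exists x.
rewrite cubeint_cst /vertex_sum big1// => w w1.
rewrite truncpow_le0 ?mulr0 ?mul0r// leNgt.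
by apply/negP => w2; apply: none; exists (vertex w); split=> //; exact: cube_vertex.
Qed.

(** On the interval the hyperplane g1 = 0 is the point xs = - r1 / A, and the
    domain is [xs, 1] if A > 0 and [0, xs] if A < 0. *)
Lemma clipint_dim1 (a b : 'rV[R]_1) r1 r2 k m w : good_clipping a b r1 r2 ->
  clipped_edge a r1 m w -> 0 < edge_value a b r1 r2 m w ->
  clipint a b r1 r2 k = vertex_sum a b r1 r2 (1 + k) - edge_sum a b r1 r2 (1 + k).
Proof.
move=> g cr ev0; have [b0 _] := good_edge g cr ev0; move: cr ev0 b0.
rewrite (ord1 m) => {m}.
have wE := tinsertK ord0 w; move: wE; rewrite (tuple0 (tremove ord0 w)) => <-.
pose A : R := a 0 ord0; pose B : R := b 0 ord0.
have aE (c : 'rV[R]_1) r (x : R) :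
    affine c r (tinsert ord0 x [tuple]) = c 0 ord0 * x + r.
  by rewrite affine_tinsert /affine big_ord0 add0r.
have avE (c : 'rV[R]_1) r e :
    affine c r (vertex (tinsert ord0 e [tuple])) = c 0 ord0 * e%:R + r :> R.
  by rewrite vertex_tinsert (_ : vertex [tuple] = [tuple]) ?aE//; exact: tuple0.
rewrite /edge_value /clipped_edge tnth_tinsert; case: (tnth w ord0) => //.
rewrite !avE -/A -/B !mulr1 [A + r1 - A]addrAC subrr add0r.
move=> cr ev0 B0.
have A0 : A != 0.
  by apply/eqP => h; move: cr; rewrite h add0r -expr2 ltNge sqr_ge0.
pose xs := - r1 / A.
have evE : B + r2 - B / A * (A + r1) = B * xs + r2 by rewrite /xs; field.
rewrite evE in ev0.
have -> : edge_sum a b r1 r2 (1 + k) = A * truncpow k.+1 (B * xs + r2) / (`|A| * B).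
  rewrite /edge_sum big_ord1 (big_tinsert _ ord0) !big_tuple0.
  rewrite /edge_value /clipped_edge !tnth_tinsert !avE -/A -/B.
  rewrite !mulr1 [A + r1 - A]addrAC subrr add0r cr /= addr0 evE.
  rewrite vertex_sign_tinsert /vertex_sign big_ord0 !mul1r.
  by rewrite big1 ?mulr1// => i; rewrite (ord1 i).
have -> : vertex_sum a b r1 r2 (1 + k) =
    (if 0 <= A + r1 then truncpow k.+1 (B + r2) / B else 0) -
    (if 0 <= r1 then truncpow k.+1 r2 / B else 0).
  rewrite /vertex_sum (big_tinsert _ ord0) !big_tuple0 !avE -/A -/B big_ord1 -/B.
  rewrite !mulr1 !mulr0 !add0r !vertex_sign_tinsert /vertex_sign big_ord0 /=.
  rewrite !mulr1 mul1r.
  by congr (_ + _); case: ifP; rewrite ?oppr0// mulN1r mulNr.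
have -> : clipint a b r1 r2 k =
    \int[mu]_(x in `[0, 1]) ((0 <= A * x + r1)%R%:R * truncpow k (B * x + r2)).
  rewrite /clipint (cubeint_slice ord0) ?cubeint_dim0; last exact: bounded_mfun_clip.
  by apply: eq_Rintegral => x _; rewrite !aE.
have slab (l u : R) : 0 <= l -> l <= u -> u <= 1 ->
    (forall x, 0 <= x <= 1 -> (0 <= A * x + r1) = (l <= x <= u)) ->
    \int[mu]_(x in `[0, 1]) ((0 <= A * x + r1)%R%:R * truncpow k (B * x + r2)) =
    (truncpow k.+1 (B * u + r2) - truncpow k.+1 (B * l + r2)) / B.
  move=> l0 lu u1 h; rewrite -(Rintegral_truncpow B r2 k lu) mulrAC mulfV// mul1r.
  rewrite [RHS]Rintegral_mkcond [LHS]Rintegral_mkcond; apply: eq_Rintegral => x _.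
  rewrite !patchE !mem_setE !in_itv/=.
  case: ifPn => x01; first by rewrite h//; case: ifP; rewrite ?mul1r ?mul0r.
  case: ifPn => // /andP[lx xu]; case/negP: x01.
  by rewrite (le_trans l0 lx) (le_trans xu u1).
have r1E : r1 = - (A * xs) by rewrite /xs; field.
have [Ap|An] : 0 < A \/ A < 0 by apply/orP; rewrite -neq_lt eq_sym.
- have r1n : r1 < 0.
    have := cr; have [//|r10] := ltP r1 0.
    by rewrite ltNge mulr_ge0// addr_ge0// ltW.
  have Ar : 0 <= A + r1 by move: cr; rewrite nmulr_llt0// => /ltW.
  have xs0 : 0 <= xs by rewrite /xs divr_ge0// ?ltW// oppr_gt0.
  have xs1 : xs <= 1 by rewrite /xs ler_pdivrMr// mul1r; lra.
  rewrite (slab xs 1)// ?mulr1; last first.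
    move=> x /andP[_ x1]; rewrite x1 andbT r1E -mulrBr pmulr_rge0// subr_ge0//.
  rewrite Ar [0 <= r1]leNgt r1n/= subr0 (gtr0_norm Ap).
  by field; rewrite A0 B0.
- have r1p : 0 <= r1.
    have := cr; have [//|r10] := leP 0 r1.
    have h : A + r1 <= 0 by lra.
    by rewrite ltNge mulr_le0 ?(ltW r10).
  have Ar : A + r1 < 0.
    move: cr; rewrite ltNge; apply: contraNT; rewrite -leNgt => h; exact: mulr_ge0.
  have xs0 : 0 <= xs by rewrite /xs mulNr -mulrN mulr_ge0// oppr_ge0 invr_le0 ltW.
  have xs1 : xs <= 1 by rewrite /xs ler_ndivrMr// mul1r; lra.
  rewrite (slab 0 xs)// ?mulr0 ?add0r; last first.
    by move=> x /andP[x0 _]; rewrite x0/= r1E -mulrBr nmulr_rge0// subr_le0.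
  rewrite r1p [0 <= A + r1]leNgt Ar/= (ltr0_norm An).
  by field; rewrite A0 B0.
Qed.

(** Induction on the dimension, by the facet recursion when a minor is nonzero. A
    clipped edge with g2 > 0 provides a nonzero minor in dimension at
    least 2, so in the parallel case it can only occur in dimension 1. *)
Lemma clipint_vertex_edge_sum n (a b : 'rV[R]_n) r1 r2 k :
  good_clipping a b r1 r2 ->
  clipint a b r1 r2 k = vertex_sum a b r1 r2 (n + k) - edge_sum a b r1 r2 (n + k).
Proof.
elim: n a b r1 r2 k => [|n IHn] a b r1 r2 k g.
  rewrite /clipint cubeint_dim0 /edge_sum big_ord0 subr0 /vertex_sum big_tuple0.
  rewrite /affine !big_ord0 !add0r /vertex_sign big_ord0 mul1r divr1.
  by case: ifP; rewrite ?mul1r ?mul0r.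
have [[s [t st0]]|par] := pselect (exists s t, minor a b s t != 0); last first.
  have m0 s t : minor a b s t = 0.
    by apply/eqP; apply: contrapT => /negP h; apply: par; exists s, t.
  have [[m [w [cr ev0]]]|none] := pselect
    (exists m w, clipped_edge a r1 m w /\ 0 < edge_value a b r1 r2 m w); last first.
    apply: clipint_parallel => // m w cr; rewrite leNgt; apply/negP => h.
    by apply: none; exists m, w.
  case: n IHn a b g par m0 m w cr ev0 => [_|n _] a b g par m0 m w cr ev0.
    exact: (clipint_dim1 k g cr ev0).
  have [_ /(_ (lift m ord0))] := good_edge g cr ev0.
  by rewrite m0 eqxx eq_sym neq_lift => /(_ isT).
apply: (mulfI st0); rewrite clipint_facets.
have F t' : clipint (col' t' a) (col' t' b) (a 0 t' + r1) (b 0 t' + r2) k.+1 -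
     clipint (col' t' a) (col' t' b) r1 r2 k.+1 =
  \sum_(w : n.+1.-tuple bool | 0 <= aff a r1 w)
    b 0 t' * (vertex_sign w * truncpow (n.+1 + k) (aff b r2 w) /
      \prod_(t < n.+1) b 0 t) -
  \sum_(m < n.+1) \sum_(w : n.+1.-tuple bool | clipped_edge a r1 m w)
    minor a b m t' * (vertex_sign w * a 0 m ^+ n *
      truncpow (n.+1 + k) (edge_value a b r1 r2 m w) /
    (`|a 0 m| * b 0 m * \prod_(t < n.+1 | t != m) minor a b m t)).
  rewrite -(facet_vertex_sum _ _ (good_vertex_coeff g)) -(facet_edge_sum _ _ (good_edge g)).
  have g1 := good_clipping_facet t' true g.
  have g0 := good_clipping_facet t' false g.
  have := IHn _ _ _ _ k.+1 g1; have := IHn _ _ _ _ k.+1 g0.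
  rewrite (_ : true%:R = 1 :> R)// (_ : false%:R = 0 :> R)// !mulr1 !mulr0 !add0r.
  by move=> -> ->; rewrite addSnnS; ring.
rewrite !F.
set Vt := \sum_(w | _) b 0 t * _; set Vs := \sum_(w | _) b 0 s * _.
set Et := \sum_(m < _) \sum_(w | _) minor a b m t * _.
set Es := \sum_(m < _) \sum_(w | _) minor a b m s * _.
have HV : a 0 s * Vt - a 0 t * Vs = minor a b s t * vertex_sum a b r1 r2 (n.+1 + k).
  rewrite !mulr_sumr -sumrB; apply: eq_bigr => w _; rewrite minorE; ring.
have HE : a 0 s * Et - a 0 t * Es = minor a b s t * edge_sum a b r1 r2 (n.+1 + k).
  rewrite !mulr_sumr -sumrB; apply: eq_bigr => m _.
  rewrite !mulr_sumr -sumrB; apply: eq_bigr => w _.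
  (* The common denominator contains minors that must not be expanded. *)
  move: (_ * _ * \prod_(_ < _ | _) _)^-1 => D.
  by rewrite !minorE exprS; ring.
by rewrite [RHS]mulrBr -HV -HE; ring.
Qed.

End clipping_formula.

(** * From the skeleta and the Lebesgue measure to the indexed formula *)

Section identification.
Context {R : realType}.
Local Notation T := (measurableTypeR R).
Local Notation mu := (@lebesgue_measure R).
Local Notation aff a r w := (affine a r (vertex w)).

Lemma tnth_vertex01 n (w : n.-tuple bool) i :
  (tnth (vertex w : n.-tuple R) i \notin [:: 0; 1]) = false.
Proof. by rewrite tnth_mktuple !inE; case: (tnth w i); rewrite eqxx ?orbT. Qed.

Lemma vertex_inj n : injective (@vertex R n).
Proof.
move=> w w' ww'; apply: eq_from_tnth => i.
have := congr1 (fun v => tnth v i) ww'; rewrite /= !tnth_mktuple.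
by case: (tnth w i); case: (tnth w' i) => // /eqP;
  rewrite ?oner_eq0 // eq_sym oner_eq0.
Qed.

Lemma skeleton0_vertex n (w : n.-tuple bool) : skeleton 0 n (vertex w : n.-tuple R).
Proof.
split; first exact: cube_vertex.
apply/eqP; rewrite cards_eq0; apply/eqP/setP => i.
by rewrite finset.in_set0 finset.in_set tnth_vertex01.
Qed.

Lemma skeleton0P n (v : n.-tuple R) : skeleton 0 n v -> exists w, v = vertex w.
Proof.
move=> [_ /eqP]; rewrite cards_eq0 => /eqP/setP h.
exists [tuple (tnth v i == 1) | i < n]; apply: eq_from_tnth => i.
have := h i; rewrite !inE !tnth_mktuple => /negbFE /orP[] /eqP ->.
  by rewrite eq_sym oner_eq0.
by rewrite eqxx.
Qed.

Lemma affine_tinsert_tremove n (c : 'rV[R]_n.+1) r (m : 'I_n.+1) x v :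
  affine c r (tinsert m x (tremove m v)) = affine c r v + c 0 m * (x - tnth v m).
Proof.
rewrite -{2}(tinsertK m v) !affine_tinsert /affine; ring.
Qed.

Lemma vertex_signE n (w : n.-tuple bool) (v : n.-tuple R) :
  (forall i, (tnth v i == 0) = ~~ tnth w i) ->
  (-1) ^+ #|zeros v| = vertex_sign w :> R.
Proof.
move=> h; rewrite -prodr_const big_mkcond; apply: eq_bigr => i _.
by rewrite inE h; case: (tnth w i).
Qed.

(** Moving from w along the edge by g1(w) / a_m makes g1 vanish. *)
Definition edge_point n (a : 'rV[R]_n.+1) r1 (m : 'I_n.+1) (w : n.+1.-tuple bool) :
  n.+1.-tuple R := tinsert m (1 - aff a r1 w / a 0 m) (tremove m (vertex w)).

Lemma edge_pointP n (a b : 'rV[R]_n.+1) r1 r2 m w : clipped_edge a r1 m w ->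
  let v := edge_point a r1 m w in
  [/\ skeleton 1 n.+1 v, star v = m, affine a r1 v = 0 &
      affine b r2 v = edge_value a b r1 r2 m w /\
      forall i, (tnth v i == 0) = ~~ tnth w i].
Proof.
move=> cr v; have a0 := clipped_edge_neq0 cr; have /andP[wm cr'] := cr.
set x := 1 - aff a r1 w / a 0 m.
have x01 : 0 < x < 1.
  have : x * (x - 1) < 0.
    have -> : x * (x - 1) = (aff a r1 w * (aff a r1 w - a 0 m)) / (a 0 m) ^+ 2.
      by rewrite /x; field.
    by rewrite pmulr_llt0// invr_gt0 exprn_even_gt0.
  by move=> h; apply/andP; split; nra.
have vm : tnth v m = x by rewrite tnth_tinsert.
have vj j : tnth v (lift m j) = (tnth w (lift m j))%:R.
  by rewrite tnth_tinsert_lift !tnth_mktuple.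
have xn : x \notin [:: 0; 1].
  by have /andP[x0 x1] := x01; rewrite !inE negb_or gt_eqF// lt_eqF.
have vP i : (tnth v i \notin [:: 0; 1]) = (i == m).
  have [j ->|->] := unliftP m i; last by rewrite vm xn eqxx.
  rewrite vj eq_sym (negbTE (neq_lift _ _)) !inE.
  by case: (tnth w _); rewrite eqxx ?orbT.
have sk : skeleton 1 n.+1 v.
  split; last first.
    rewrite (_ : [set i | _]%SET = [set m]%SET) ?cards1//.
    by apply/setP => i; rewrite !inE -vP !inE.
  move=> i; have [j ->|->] := unliftP m i; last by rewrite vm; have := x01; lra.
  by rewrite vj; case: (tnth w _); rewrite ?lexx ler01.
have wm1 : tnth (vertex w : n.+1.-tuple R) m = 1 by rewrite tnth_mktuple wm.
split=> //.
- by apply/eqP; rewrite eq_sym -(starP sk) vP.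
- by rewrite affine_tinsert_tremove wm1 /x; field.
- split; first by rewrite affine_tinsert_tremove wm1 /edge_value; field.
  move=> i; have [j ->|->] := unliftP m i; last first.
    by rewrite vm wm gt_eqF//; case/andP: x01.
  by rewrite vj; case: (tnth w _); rewrite ?eqxx ?oner_eq0.
Qed.

Lemma edge_point_inj n (a : 'rV[R]_n.+1) r1 m w m' w' :
  clipped_edge a r1 m w -> clipped_edge a r1 m' w' ->
  edge_point a r1 m w = edge_point a r1 m' w' -> m = m' /\ w = w'.
Proof.
move=> cr cr' e; have [_ s _ [_ z]] := edge_pointP a r1 cr.
have [_ s' _ [_ z']] := edge_pointP a r1 cr'.
split; first by rewrite -s -s' e.
by apply: eq_from_tnth => i; apply: negb_inj; rewrite -z -z' e.
Qed.

Lemma edge_point_surj n (a : 'rV[R]_n.+1) r1 v : skeleton 1 n.+1 v ->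
  affine a r1 v = 0 -> a 0 (star v) != 0 ->
  exists w, clipped_edge a r1 (star v) w /\ edge_point a r1 (star v) w = v.
Proof.
move=> sk v0; set m := star v => a0; have sP := starP sk; have [cv _] := sk.
pose w : n.+1.-tuple bool :=
  tinsert m true [tuple (tnth v (lift m j) == 1) | j < n].
have dw : tremove m (vertex w) = tremove m v.
  apply: eq_from_tnth => j; rewrite [RHS]tnth_mktuple.
  rewrite [LHS]tnth_mktuple [LHS]tnth_mktuple tnth_tinsert_lift tnth_mktuple.
  have := sP (lift m j); rewrite eq_sym (negbTE (neq_lift _ _)) !inE => /negbFE.
  by move=> /orP[] /eqP ->; rewrite ?eqxx// eq_sym oner_eq0.
have wm : tnth w m by rewrite tnth_tinsert.
have wm1 : tnth (vertex w : n.+1.-tuple R) m = 1 by rewrite tnth_mktuple wm.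
have wE : aff a r1 w = a 0 m * (1 - tnth v m).
  have : affine a r1 (tinsert m (tnth v m) (tremove m (vertex w))) = 0.
    by rewrite dw tinsertK.
  by rewrite affine_tinsert_tremove wm1 => /eqP; rewrite addr_eq0 => /eqP ->; ring.
have xE : 1 - aff a r1 w / a 0 m = tnth v m by rewrite wE; field.
exists w; split; last by rewrite /edge_point xE dw tinsertK.
rewrite /clipped_edge wm wE /=.
have -> : a 0 m * (1 - tnth v m) * (a 0 m * (1 - tnth v m) - a 0 m) =
  - (a 0 m ^+ 2 * ((1 - tnth v m) * tnth v m)) by ring.
have := sP m; rewrite eqxx !inE negb_or => /andP[v0' v1'].
have /andP[v0'' v1''] := cv m.
rewrite oppr_lt0 mulr_gt0 ?exprn_even_gt0// mulr_gt0// ?subr_gt0 lt_neqAle.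
  by rewrite v1' v1''.
by rewrite eq_sym v0' v0''.
Qed.

Lemma fsbig_finType (I : finType) (J : choiceType) (h : I -> J) (P : pred I)
    (A : set J) (F : J -> R) :
  (forall i, P i -> A (h i)) ->
  (forall i i', P i -> P i' -> h i = h i' -> i = i') ->
  (forall j, A j -> exists2 i, P i & h i = j) ->
  \sum_(j \in A) F j = \sum_(i | P i) F (h i).
Proof.
move=> PA hinj hsurj.
rewrite (reindex_fsbig h [set` P]); last first.
  split=> [i|i i'|j /hsurj[i Pi <-]].
  - exact: PA.
  - by rewrite !inE => Pi Pi'; exact: hinj.
  - by exists i.
rewrite -(bigfs _ (r := index_enum I)) ?index_enum_uniq// => i _.
by rewrite mem_index_enum.
Qed.

(** The function is a multiple of the indicator of a point, which also makes its
    measurability automatic. *)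
Lemma Rintegral_single (f : R -> R) (x0 l u : R) :
  (forall x, x != x0 -> f x = 0) -> \int[mu]_(x in `[l, u]) f x = 0.
Proof.
move=> f0; transitivity (\int[mu]_(x in `[l, u]) (f x0 * \1_[set x0] x)).
  apply: eq_Rintegral => x _; rewrite indicE; have [->|xx0] := eqVneq x x0.
    by rewrite mem_set// mulr1.
  by rewrite f0// memNset ?mulr0//; apply/eqP.
have m0 : (mu ([set x0] `&` `[l, u]) = 0)%E.
  apply/eqP; rewrite eq_le measure_ge0 andbT -(lebesgue_measure_set1 x0).
  by apply: le_measure; rewrite ?inE//; exact: measurableI.
rewrite RintegralZl//; last first.
  apply: (@bounded_integrable_itv _ _ _ _ 1); first exact: measurable_indic.
  by move=> x _; rewrite indicE; case: (_ \in _); rewrite ?normr0 ?normr1.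
have -> : \int[mu]_(x in `[l, u]) \1_[set x0] x =
    fine (mu ([set x0] `&` `[l, u])).
  by rewrite /Rintegral integral_indic.
by rewrite m0 mulr0.
Qed.

Lemma locbounded_eq0 : locbounded_mfun (fun y : R => (y == 0)%R%:R).
Proof.
split; last by move=> K; exists 1 => y _; case: (y == 0); rewrite ?normr1 ?normr0.
rewrite (_ : (fun _ => _) = \1_[set 0]); first exact: measurable_indic.
by apply/funext => y; rewrite indicE; have [->|y0] := eqVneq y 0;
  [rewrite mem_set|rewrite memNset//; apply/eqP].
Qed.

(** truncpow 0 omits the hyperplane g2 = 0, which is negligible: along a
    coordinate t with b_t != 0 every slice meets it in one point. *)
Lemma volume_clipint n (a b : 'rV[R]_n.+1) r1 r2 : b != 0 ->
  lebesgue_tuple n.+1 (cube n.+1 `&` halfspace a r1 `&` halfspace b r2) =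
  (clipint a b r1 r2 0)%:E.
Proof.
move=> b0.
have [t bt] : exists t, b 0 t != 0.
  apply: contrapT => /forallNP h; move/eqP: b0; apply; apply/rowP => i.
  by rewrite mxE; have /negP := h i; rewrite negbK => /eqP.
pose S : set (n.+1.-tuple T) := halfspace a r1 `&` halfspace b r2.
have SE x : \1_S x = (0 <= affine a r1 x)%R%:R * (0 <= affine b r2 x)%R%:R :> R.
  rewrite indicE -natrM mulnb; congr (nat_of_bool _)%:R.
  by apply/idP/andP => [/[!inE] -[]|[h1 h2]]//; rewrite inE.
have bS : bounded_mfun (fun x : n.+1.-tuple R => \1_S x : R).
  rewrite (_ : (fun x => _) = fun x =>
      (0 <= affine a r1 x)%R%:R * (0 <= affine b r2 x)%R%:R).
    by apply: bounded_mfunM; apply: (bounded_mfun_comp locbounded_nneg);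
      exact: bounded_mfun_affine.
  by apply/funext.
have mS : measurable S.
  have [m1 _] := bS.
  have : measurable ((\1_S : n.+1.-tuple T -> R) @^-1` [set 1]).
    by rewrite -[X in measurable X]setTI; exact: m1.
  rewrite (_ : _ @^-1` _ = S)//; apply/seteqP; split=> x /=.
    rewrite indicE; case: (boolP (x \in S)) => [/[!inE]//|_ /eqP].
    by rewrite eq_sym oner_eq0.
  by move=> Sx; rewrite indicE mem_set.
have : cubeint (fun x => \1_S x) = clipint a b r1 r2 0.
  have bz : bounded_mfun (fun x : n.+1.-tuple R =>
      (0 <= affine a r1 x)%R%:R * (affine b r2 x == 0)%R%:R : R).
    apply: bounded_mfunM.
      by apply: (bounded_mfun_comp locbounded_nneg); exact: bounded_mfun_affine.
    by apply: (bounded_mfun_comp locbounded_eq0); exact: bounded_mfun_affine.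
  transitivity (clipint a b r1 r2 0 +
      cubeint (fun x => (0 <= affine a r1 x)%R%:R * (affine b r2 x == 0)%R%:R)).
    rewrite -cubeintD//; last exact: bounded_mfun_clip.
    apply: eq_cubeint => x _; rewrite SE -mulrDr; congr (_ * _).
    by rewrite /truncpow; case: ltgtP; rewrite ?expr0 ?fact0 ?divr1 ?addr0 ?add0r.
  rewrite (cubeint_slice t)// (@eq_cubeint _ _ _ (fun _ => 0)) ?cubeint_cst ?addr0//.
  move=> y _; apply: (@Rintegral_single _ (- affine (col' t b) r2 y / b 0 t)) => x xx0.
  rewrite affine_tinsert [affine b _ _ == 0](_ : _ = false) ?mulr0//.
  apply/negbTE; apply: contra xx0 => /eqP h; apply/eqP.
  apply: (mulfI bt); move: h; rewrite affine_tinsert /affine => h.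
  rewrite -[LHS](addrK (\sum_(i < n.+1.-1) col' t b 0 i * tnth y i + r2)).
  by rewrite addrCA h; field.
move=> <-; rewrite -setIA -/S /cubeint /Rintegral fineK; last first.
  apply: integrable_fin_num; first exact: measurable_cube.
  exact: bounded_mfun_integrable.
by rewrite (integral_indic _ (@measurable_cube R n.+1))// setIC.
Qed.

End identification.

Theorem corollary1p2 (R : realType) (n : nat)
    (a b : 'rV[R]_n.+1) (r1 r2 : R) (ha : a != 0) (hb : b != 0)
    (hA : ~ exists v : n.+1.-tuple R,
       [/\ skeleton 0 n.+1 v, affine a r1 v = 0 & 0 < affine b r2 v])
    (hB1 : (exists v : n.+1.-tuple R,
       [/\ skeleton 0 n.+1 v, 0 <= affine a r1 v & 0 < affine b r2 v]) ->
       \prod_(t < n.+1) b 0 t != 0)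
    (hB2 : forall v : n.+1.-tuple R,
       skeleton 1 n.+1 v -> affine a r1 v = 0 -> 0 < affine b r2 v ->
       b 0 (star v) * \prod_(t < n.+1 | t != star v) minor a b (star v) t != 0) :
  lebesgue_tuple n.+1 (cube n.+1 `&` halfspace a r1 `&` halfspace b r2) =
  (\sum_(v \in (skeleton 0 n.+1 `&` halfspace a r1 `&` halfspace b r2)
                `\` hyperplane b r2)
      ((-1) ^+ #|zeros v| * affine b r2 v ^+ n.+1) /
      (n.+1`!%:R * \prod_(t < n.+1) b 0 t)
   - \sum_(v \in (skeleton 1 n.+1 `&` hyperplane a r1 `&` halfspace b r2)
                  `\` hyperplane b r2)
      ((-1) ^+ #|zeros v| * a 0 (star v) ^+ n.+1 * affine b r2 v ^+ n.+1) /
      (n.+1`!%:R * `|a 0 (star v)| * b 0 (star v) *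
       \prod_(t < n.+1 | t != star v) minor a b (star v) t))%:E.
Proof.
have g : good_clipping a b r1 r2.
  split=> [w w2|w w1 w2 t|m w cr ev0].
  - apply/eqP => w1; apply: hA; exists (vertex w); split=> //; exact: skeleton0_vertex.
  - have /prodf_neq0 : \prod_(t < n.+1) b 0 t != 0.
      by apply: hB1; exists (vertex w); split=> //; exact: skeleton0_vertex.
    exact.
  - have [sk st v1 [v2 _]] := edge_pointP b r2 cr.
    have := hB2 _ sk v1; rewrite v2 st mulf_eq0 negb_or.
    move=> /(_ ev0) /andP[? /prodf_neq0 h].
    by split.
rewrite volume_clipint// (clipint_vertex_edge_sum _ g) addn0; congr (_ - _)%:E.
  rewrite (@fsbig_finType _ _ _ (@vertex R n.+1)
    (fun w => (0 <= affine a r1 (vertex w)) && (0 < affine b r2 (vertex w)))); last 3 first.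
  - move=> w /andP[w1 w2]; split; last by move=> /= h; move: w2; rewrite h ltxx.
    by split; [split; [exact: skeleton0_vertex|]|exact: ltW].
  - by move=> w w' _ _; exact: vertex_inj.
  - move=> v [[[/skeleton0P[w ->] w1] w2] w3]; exists w => //; rewrite w1/=.
    by rewrite lt_neqAle w2 andbT eq_sym; apply/eqP.
  rewrite big_mkcondr; apply: eq_bigr => w w1.
  rewrite /truncpow; case: ifPn => w2; last by rewrite mulr0 mul0r.
  rewrite (@vertex_signE _ _ w); last first.
    by move=> i; rewrite tnth_mktuple; case: (tnth w i); rewrite ?eqxx ?oner_eq0.
  by rewrite invfM !mulrA.
rewrite /edge_sum (pair_big_dep xpredT (fun m w => clipped_edge a r1 m w)) /=.
rewrite (@fsbig_finType _ _ _ (fun p => edge_point a r1 p.1 p.2)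
  (fun p => clipped_edge a r1 p.1 p.2 && (0 < edge_value a b r1 r2 p.1 p.2)));
  last 3 first.
- move=> [m w] /= /andP[cr ev0]; have [sk st v1 [v2 _]] := edge_pointP b r2 cr.
  split; last by rewrite /hyperplane/= v2 => h; move: ev0; rewrite h ltxx.
  by split; [split|rewrite /halfspace/= v2 ltW].
- move=> [m w] [m' w'] /= /andP[cr _] /andP[cr' _] /(edge_point_inj cr cr').
  by case=> -> ->.
- move=> v [[[sk v1] v2] v3].
  have v2' : 0 < affine b r2 v by rewrite lt_neqAle v2 andbT eq_sym; apply/eqP.
  (* If a_m = 0 for the direction m of the edge of v, then g1 vanishes on the
     whole edge, and g2 > 0 at the endpoint towards which g2 does not decrease. *)
  have a0 : a 0 (star v) != 0.
    apply/eqP => a0; apply: hA.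
    pose e := 0 <= b 0 (star v).
    exists (tinsert (star v) e%:R (tremove (star v) v)); split.
    - split.
        have [cv _] := sk; move: cv.
        rewrite -{1}(tinsertK (star v) v) => /cube_tinsert[_ cv].
        by apply/cube_tinsert; split=> //; case: e; rewrite ?lexx ler01.
      apply/eqP; rewrite cards_eq0; apply/eqP/setP => i; rewrite !inE.
      have [j ->|->] := unliftP (star v) i; last first.
        by rewrite tnth_tinsert; case: e; rewrite eqxx ?orbT.
      have := starP sk (lift (star v) j); rewrite eq_sym (negbTE (neq_lift _ _)).
      by rewrite tnth_tinsert_lift tnth_mktuple !inE.
    - by rewrite affine_tinsert_tremove a0 mul0r addr0.
    - rewrite affine_tinsert_tremove; apply: (lt_le_trans v2'); rewrite lerDl.
      have [cv _] := sk; have /andP[x0 x1] := cv (star v).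
      rewrite /e; case: (leP 0 (b 0 (star v))) => b0.
        by rewrite mulr_ge0// subr_ge0.
      by rewrite mulr_le0 ?(ltW b0)// sub0r oppr_le0.
  have [w [cr e]] := edge_point_surj sk v1 a0.
  exists (star v, w) => //=; rewrite cr/=.
  have [_ _ _ [ve _]] := edge_pointP b r2 cr.
  by rewrite -ve e.
rewrite [RHS]big_mkcondr; apply: eq_bigr => -[m w] /= cr.
have [_ st _ [v2 z]] := edge_pointP b r2 cr.
rewrite /truncpow; case: ifPn => ev0; last by rewrite mulr0 mul0r.
rewrite (vertex_signE z) st v2 -!(mulrA n.+1`!%:R).
move: (_ * _ * \prod_(_ < _ | _) _) => D.
by rewrite invfM !mulrA.
Qed.
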